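(* Let $(A,\sigma)$ be an $F$-algebra with involution, let $P\in X_F$, let $L/F$ be a finite extension of ordered (i.e. formally real) fields, and let $h$ be a hermitian form over $(A\otimes_F L,\sigma\otimes\mathrm{id})$. Fix a real closure $\iota:F\to F_P$ of $F$ at $P$ and a Morita equivalence $\mathscr{M}:\mathscr{H}(A\otimes_F F_P,\sigma\otimes\mathrm{id})\to\mathscr{H}_{\varepsilon_P}(D_P,\vartheta_P)$. With $r$, $\omega_i$, $\iota_0$, $\iota_1$ as defined in the context, $$\mathrm{sign}_{\iota}^{\mathscr{M}}\bigl(\mathrm{Tr}^*_{A\otimes_F L}\,h\bigr)=\sum_{i=1}^r \mathrm{sign}_{\omega_i\circ\iota_1}^{(\omega_i\circ\iota_0)(\mathscr{M})}\,h .$$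
   Context: **Algebras with involution and forms.** $F$ is a formally real field and $X_F$ is its space of orderings. An $F$-algebra with involution is a pair $(A,\sigma)$ with $A$ a finite-dimensional $F$-algebra and $\sigma:A\to A$ an $F$-linear map with $\sigma(xy)=\sigma(y)\sigma(x)$, $\sigma^2=\mathrm{id}$, such that either ($\sigma$ of the first kind) $A$ is simple with centre $F$, or ($\sigma$ of the second kind, or unitary) $A$ is simple with centre a quadratic field extension $F(\sqrt d)$ of $F$ on which $\sigma$ acts nontrivially. If $\sigma$ is of the first kind and $\dim_F A=m^2$, then $\sigma$ is orthogonal (resp. symplectic) if $\{a\in A:\sigma(a)=a\}$ has $F$-dimension $m(m+1)/2$ (resp. $m(m-1)/2$). For $\varepsilon\in\{-1,1\}$, an $\varepsilon$-hermitian form over a ring with involution $(A,\sigma)$ is a finitely generated right module $M$ (always projective here) with a biadditive $h:M\times M\to A$ such that $h(xa,yb)=\sigma(a)h(x,y)b$ and $h(y,x)=\varepsilon\sigma(h(x,y))$; hermitian means $\varepsilon=1$. All forms are assumed nonsingular. $\mathscr{H}_\varepsilon(A,\sigma)$ is the category of nonsingular $\varepsilon$-hermitian forms with isometries as morphisms, $W_\varepsilon(A,\sigma)$ the Witt group; the subscript is dropped when $\varepsilon=1$. Forms are identified with their Witt classes. **Signatures, real closed case.** Let $R$ be real closed. For a symmetric bilinear form over $R$, a hermitian form over $(R(\sqrt{-1}),-)$ (conjugation), or a hermitian form over $((-1,-1)_R,-)$ (quaternion conjugation), diagonalize as $\langle\alpha_1,\dots,\alpha_n\rangle$ with $\alpha_i\in\{-1,1\}$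 and put $\mathrm{sign}=\sum\alpha_i$. For skew-symmetric forms over $R$, hermitian forms over $(R\times R,\text{exchange involution }(x,y)\mapsto(y,x))$ and skew-hermitian forms over $((-1,-1)_R,-)$, put $\mathrm{sign}=0$. **$M$-signature.** A real closure of $F$ at $P$ is a field embedding $\iota:F\to F_P$ with $F_P$ real closed, $\iota(P)\subseteq F_P^2$ and $F_P$ algebraic over $\iota(F)$. Tensor products with $F_P$ are along $\iota$. The algebra with involution $(A\otimes_F F_P,\sigma\otimes\mathrm{id})$ is (hermitian) Morita equivalent to $(D_P,\vartheta_P)$, where: if $\sigma$ is of the first kind, $(D_P,\vartheta_P)=(F_P,\mathrm{id})$ or $(H_P,-)$ with $H_P=(-1,-1)_{F_P}$, according to whether $A\otimes_F F_P$ is a matrix algebra over $F_P$ or over $H_P$; if $\sigma$ is unitary, $(D_P,\vartheta_P)=(F_P(\sqrt{-1}),-)$ if $d<_P0$ and $(F_P\times F_P,\text{exchange})$ if $d>_P0$. Put $\varepsilon_P=-1$ if one of $\sigma,\vartheta_P$ is orthogonal and the other symplectic ($\mathrm{id}$ on $F_P$ being orthogonal and $-$ on $H_P$ symplectic), $\varepsilon_P=1$ otherwise. A Morita equivalence $\mathscr{M}:\mathscr{H}(A\otimes_F F_P,\sigma\otimes\mathrm{id})\to\mathscr{H}_{\varepsilon_P}(D_P,\vartheta_P)$ is an equivalence of categories given by hermitian Morita theory; it respects isometries, orthogonal sums and hyperbolic forms and induces a group isomorphism of Witt groups, also denoted $\mathscr{M}$. For a hermitian form $h$ over $(A,\sigma)$,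 $\mathrm{sign}_\iota^{\mathscr{M}}h:=\mathrm{sign}\,\mathscr{M}(h\otimes F_P)$, where $h\otimes F_P=(\mathrm{id}_A\otimes\iota)^*(h)$. The same definition is used over $L$: for a real closure $\kappa:L\to K$ of $L$ at an ordering, a Morita equivalence $\mathscr{M}'$ from $\mathscr{H}((A\otimes_F L)\otimes_L K,\sigma\otimes\mathrm{id})=\mathscr{H}(A\otimes_F K,\sigma\otimes \mathrm{id})$ to the corresponding $\mathscr{H}_\varepsilon(D,\vartheta)$, and $h$ over $(A\otimes_F L,\sigma\otimes\mathrm{id})$, $\mathrm{sign}_\kappa^{\mathscr{M}'}h:=\mathrm{sign}\,\mathscr{M}'((\mathrm{id}_A\otimes\kappa)^*h)$. **Transport of Morita equivalences.** If $\rho:F_P\to K$ is an isomorphism of fields, extend $\rho$ canonically to $D_P$, regard $A\otimes_F K$ via $\rho\circ\iota$, and let $\rho(\mathscr{M}):\mathscr{H}(A\otimes_F K,\sigma\otimes\mathrm{id})\to\mathscr{H}_{\varepsilon_P}(\rho(D_P),\rho\circ\vartheta_P\circ\rho^{-1})$ be the Morita equivalence with $\rho(\mathscr{M})\circ(\mathrm{id}\otimes\rho)^*=\rho^*\circ\mathscr{M}$. **Extensions of $P$ to $L$.** Write $L=F[X]/(R)$ and factor $R=R_1\cdots R_t$ into pairwise distinct irreducibles in $F_P[X]$ with $\deg R_1=\dots=\deg R_r=1$ and $\deg R_{r+1}=\dots=\deg R_t=2$. This gives an $F_P$-algebra isomorphism $\omega:L\otimes_F F_P\to F_1\times\cdots\times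 F_t$, $F_i=F_P[X]/(R_i)$; $F_i$ is real closed for $i\le r$ and algebraically closed for $i>r$. Let $\omega_i$ be $\omega$ followed by projection to $F_i$, and $\iota_0:F_P\to L\otimes_F F_P$, $\iota_1:L\to L\otimes_F F_P$ the canonical inclusions. For $1\le i\le r$, $\omega_i\circ\iota_0:F_P\to F_i$ is an isomorphism, and $\omega_i\circ\iota_1:L\to F_i$ is a real closure of $L$ at $Q_i$, where $Q_1,\dots,Q_r$ are the distinct orderings of $L$ extending $P$. **Transfer.** $\mathrm{Tr}_{A\otimes_F L}=\mathrm{id}_A\otimes\mathrm{Tr}_{L/F}:A\otimes_F L\to A$, and $\mathrm{Tr}^*_{A\otimes_F L}:W(A\otimes_F L,\sigma\otimes\mathrm{id})\to W(A,\sigma)$ is $(M,h)\mapsto(M,\mathrm{Tr}_{A\otimes_F L}\circ h)$, with $M$ regarded as a right $A$-module. *)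

(* Defs.v *)
From HB Require Import structures.
From mathcomp Require Import all_boot all_order all_algebra all_field.
From mathcomp Require Import generic_quotient.
From mathcomp Require Import boolp classical_sets.
From mathcomp Require Import complex.
From mathcomp Require Import ring.

Set Implicit Arguments.
Unset Strict Implicit.
Unset Printing Implicit Defensive.

Import GRing.Theory VectorInternalTheory.
Local Open Scope ring_scope.
Local Open Scope quotient_scope.

(* A right B-module is a left module over the converse ring B^c. *)
Definition rmul (B : nzRingType) (M : lmodType B^c) (x : M) (b : B) : M :=
  (b : B^c) *: x.
Notation "x *r b" := (rmul x b) (at level 40, left associativity).

Section RMul.
Variables (B : nzRingType) (M : lmodType B^c).
Implicit Types (x y : M) (a b : B).
Lemma rmulDl x y b : (x + y) *r b = x *r b + y *r b.
Proof. exact: scalerDr. Qed.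
Lemma rmulDr x a b : x *r (a + b) = x *r a + x *r b.
Proof. exact: scalerDl. Qed.
Lemma rmulA x a b : x *r a *r b = x *r (a * b).
Proof. exact: scalerA. Qed.
Lemma rmul1 x : x *r 1 = x.
Proof. exact: scale1r. Qed.
End RMul.

Record involution (B : nzRingType) := Involution {
  inv_fun :> {additive B -> B};
  inv_funM : forall x y, inv_fun (x * y) = inv_fun y * inv_fun x;
  inv_funK : involutive inv_fun }.

Lemma inv_fun1 (B : nzRingType) (s : involution B) : s 1 = 1.
Proof. by have := inv_funM s (s 1) 1; rewrite mulr1 inv_funK mulr1. Qed.

(* The sign epsilon is encoded by e : bool as (-1) ^+ e: false stands for    *)
(* hermitian, true for skew-hermitian.                                       *)
Record is_herm (B : nzRingType) (s : involution B) (e : bool)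
    (M : lmodType B^c) (h : M -> M -> B) : Prop := IsHerm {
  herm_addl : forall x x' y, h (x + x') y = h x y + h x' y;
  herm_addr : forall x y y', h x (y + y') = h x y + h x y';
  herm_scale : forall x y a b, h (x *r a) (y *r b) = s a * h x y * b;
  herm_sym : forall x y, h y x = (-1) ^+ e * s (h x y) }.

Record hform (B : nzRingType) (s : involution B) (e : bool) := HForm {
  hmod :> lmodType B^c;
  hval : hmod -> hmod -> B;
  hvalP : is_herm s e hval }.

Definition isometric (B : nzRingType) (s : involution B) (e : bool)
    (h h' : hform s e) : Prop :=
  exists2 f : {linear h -> h'}, bijective f
    & forall x y, hval (f x) (f y) = hval x y.

(* Direct summand of a free module of finite rank. *)
Definition fg_projective (B : nzRingType) (M : lmodType B^c) : Prop :=
  exists n (i : {linear M -> 'rV[B^c]_n}) (p : {linear 'rV[B^c]_n -> M}),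
    cancel i p.

(* The dual module consists of the right B-linear maps M -> B, i.e. of the   *)
(* linear maps from M to the regular B^c-module.                             *)
Definition nonsingular (B : nzRingType) (M : lmodType B^c) (h : M -> M -> B) :
    Prop :=
  forall f : {linear M -> (B^c)^o}, exists! x, forall y, f y = h x y :> B.

Record nonsingular_hform (B : nzRingType) (s : involution B) (e : bool)
    (h : hform s e) : Prop := NonsingularHForm {
  nsh_fgproj : fg_projective h;
  nsh_nonsing : nonsingular (@hval _ _ _ h) }.

Record is_bimod (B D : nzRingType) (N : lmodType D^c) (act : B -> N -> N) :
    Prop := IsBimod {
  is_bimodDl : forall a b x, act (a + b) x = act a x + act b x;
  is_bimodDr : forall a x y, act a (x + y) = act a x + act a y;
  is_bimodM : forall a b x, act (a * b) x = act a (act b x);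
  is_bimod1 : forall x, act 1 x = x;
  is_bimodC : forall a x d, act a (x *r d) = act a x *r d }.

Record bimod (B D : nzRingType) := Bimod {
  bcar :> lmodType D^c;
  lact : B -> bcar -> bcar;
  lactP : is_bimod lact }.

Section LAct.
Variables (B D : nzRingType) (N : bimod B D).
Implicit Types (x y : N) (a b : B).
Lemma lactDl a b x : lact (a + b) x = lact a x + lact b x.
Proof. exact: (is_bimodDl (lactP N)). Qed.
Lemma lactDr a x y : lact a (x + y) = lact a x + lact a y.
Proof. exact: (is_bimodDr (lactP N)). Qed.
Lemma lactM a b x : lact (a * b) x = lact a (lact b x).
Proof. exact: (is_bimodM (lactP N)). Qed.
Lemma lact1 x : lact 1 x = x.
Proof. exact: (is_bimod1 (lactP N)). Qed.
Lemma lactC a x (d : D) : lact a (x *r d) = lact a x *r d.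
Proof. exact: (is_bimodC (lactP N)). Qed.
End LAct.

Section Tensor.
Variables (B D : nzRingType) (M : lmodType B^c) (N : bimod B D).

(* The tensor product of M and N over B: formal sums of pairs modulo the     *)
(* congruence generated by the balanced bilinearity relations.               *)
Inductive teq : seq (M * N) -> seq (M * N) -> Prop :=
| teq_refl s : teq s s
| teq_sym s t : teq s t -> teq t s
| teq_trans s t u : teq s t -> teq t u -> teq s u
| teq_cat s s' t t' : teq s s' -> teq t t' -> teq (s ++ t) (s' ++ t')
| teq_catC s t : teq (s ++ t) (t ++ s)
| teq_0 n : teq [:: (0, n)] [::]
| teq_Dl m m' n : teq [:: (m + m', n)] [:: (m, n); (m', n)]
| teq_Dr m n n' : teq [:: (m, n + n')] [:: (m, n); (m, n')]
| teq_bal m a n : teq [:: (m *r a, n)] [:: (m, lact a n)].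

Definition teqb (s t : seq (M * N)) : bool := `[< teq s t >].

Lemma teqb_refl : reflexive teqb.
Proof. by move=> s; apply/asboolP/teq_refl. Qed.
Lemma teqb_sym : symmetric teqb.
Proof. by move=> s t; apply/asboolP/asboolP; apply: teq_sym. Qed.
Lemma teqb_trans : transitive teqb.
Proof. by move=> t s u /asboolP st /asboolP tu; apply/asboolP/(teq_trans st). Qed.

Canonical teq_equiv := EquivRel teqb teqb_refl teqb_sym teqb_trans.

Definition tens : Type := {eq_quot teq_equiv}%qT.
HB.instance Definition _ := Choice.on tens.
HB.instance Definition _ := Quotient.on tens.
HB.instance Definition _ := EqQuotient.on tens.

Definition tpi (s : seq (M * N)) : tens := \pi_tens s.
Definition trepr (x : tens) : seq (M * N) := repr x.
Definition pure (m : M) (n : N) : tens := tpi [:: (m, n)].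

Lemma treprK x : tpi (trepr x) = x.
Proof. exact: reprK. Qed.

Lemma tpiP s t : (tpi s = tpi t) <-> teq s t.
Proof. by rewrite /tpi; split=> [/eqquotP/asboolP|st] //; apply/eqquotP/asboolP. Qed.

Lemma trepr_tpi s : teq (trepr (tpi s)) s.
Proof. by apply/tpiP; rewrite treprK. Qed.

Definition tens_add x y := tpi (trepr x ++ trepr y).
Definition tens_neg (s : seq (M * N)) := [seq (- p.1, p.2) | p <- s].
Definition tens_opp x := tpi (tens_neg (trepr x)).

Lemma teq_negr s : teq (tens_neg s ++ s) [::].
Proof.
elim: s => [|[m n] s IHs] /=; first exact: teq_refl.
rewrite -cat1s; apply: teq_trans (teq_cat (teq_refl _) (teq_catC _ _)) _.
rewrite -(cat1s (m, n)) -catA (catA [:: _]).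
apply: (@teq_trans _ ([::] ++ [::])); last exact: teq_refl.
apply: teq_cat; last by apply: teq_trans (teq_catC _ _) _.
apply: teq_trans (teq_sym (teq_Dl _ _ _)) _.
by rewrite addNr; apply: teq_0.
Qed.

Lemma tens_addA : associative tens_add.
Proof.
move=> x y z; apply/tpiP.
apply: (@teq_trans _ (trepr x ++ (trepr y ++ trepr z))).
  by apply: teq_cat; [exact: teq_refl | exact: trepr_tpi].
rewrite catA; apply: teq_cat; last exact: teq_refl.
exact/teq_sym/trepr_tpi.
Qed.
Lemma tens_addC : commutative tens_add.
Proof. by move=> x y; apply/tpiP/teq_catC. Qed.
Lemma tens_add0 : left_id (tpi [::]) tens_add.
Proof.
move=> x; rewrite -[RHS]treprK; apply/tpiP.
by apply: (@teq_cat _ [::] _ _ (trepr_tpi _)); exact: teq_refl.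
Qed.
Lemma tens_addN : left_inverse (tpi [::]) tens_opp tens_add.
Proof.
move=> x; apply/tpiP; apply: teq_trans (teq_negr (trepr x)).
by apply: teq_cat; [exact: trepr_tpi | exact: teq_refl].
Qed.

HB.instance Definition _ :=
  GRing.isZmodule.Build tens tens_addA tens_addC tens_add0 tens_addN.

Definition tens_rmul (d : D) (s : seq (M * N)) := [seq (p.1, p.2 *r d) | p <- s].

Lemma teq_rmul d s t : teq s t -> teq (tens_rmul d s) (tens_rmul d t).
Proof.
rewrite /tens_rmul; elim=> {s t} [s|s t _|s t u _ IH1 _ IH2|s s' t t' _ IH1 _ IH2|s t|n|m m' n|m n n'|m a n] /=.
- exact: teq_refl.
- exact: teq_sym.
- exact: teq_trans IH1 IH2.
- by rewrite !map_cat; apply: teq_cat.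
- by rewrite !map_cat; apply: teq_catC.
- exact: teq_0.
- exact: teq_Dl.
- by rewrite rmulDl; apply: teq_Dr.
- by rewrite -lactC; apply: teq_bal.
Qed.

Definition tens_scale (d : D^c) (x : tens) : tens := tpi (tens_rmul d (trepr x)).

Lemma tens_scaleE d s : tens_scale d (tpi s) = tpi (tens_rmul d s).
Proof. by apply/tpiP/teq_rmul/trepr_tpi. Qed.

Lemma tpiD s t : tpi (s ++ t) = tpi s + tpi t.
Proof. by apply/tpiP/teq_sym/teq_cat; apply: trepr_tpi. Qed.

Lemma tpi_cons m n s : tpi ((m, n) :: s) = pure m n + tpi s.
Proof. by rewrite -cat1s tpiD. Qed.

Lemma tpi_sum s : tpi s = \sum_(p <- s) pure p.1 p.2.
Proof.
elim: s => [|[m n] s IHs]; first by rewrite big_nil.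
by rewrite big_cons tpi_cons IHs.
Qed.

Lemma pureDr m n n' : pure m (n + n') = pure m n + pure m n'.
Proof. by rewrite -tpiD; apply/tpiP/teq_Dr. Qed.
Lemma pureDl m m' n : pure (m + m') n = pure m n + pure m' n.
Proof. by rewrite -tpiD; apply/tpiP/teq_Dl. Qed.
Lemma pure_bal m a n : pure (m *r a) n = pure m (lact a n).
Proof. exact/tpiP/teq_bal. Qed.

Lemma tens_scaleA a b v : tens_scale a (tens_scale b v) = tens_scale (a * b) v.
Proof.
rewrite -(treprK v) !tens_scaleE; congr tpi.
by rewrite /tens_rmul -map_comp; apply: eq_map => p /=; rewrite rmulA.
Qed.
Lemma tens_scale1 : left_id 1 tens_scale.
Proof.
move=> v; rewrite -[RHS]treprK -[in LHS](treprK v) tens_scaleE; congr tpi.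
by rewrite -[RHS]map_id; apply: eq_map => -[m n] /=; rewrite rmul1.
Qed.
Lemma tens_scaleDr : right_distributive tens_scale +%R.
Proof.
move=> a u v; rewrite -(treprK u) -(treprK v) -tpiD !tens_scaleE -tpiD.
by rewrite /tens_rmul map_cat.
Qed.
Lemma tens_scaleDl v : {morph tens_scale^~ v : a b / a + b}.
Proof.
move=> a b; rewrite -(treprK v) !tens_scaleE.
elim: (trepr v) => [|[m n] s IHs]; first by rewrite /= addr0.
by rewrite /= !tpi_cons IHs /= rmulDr pureDr addrACA.
Qed.

HB.instance Definition _ := GRing.Zmodule_isLmodule.Build D^c tens
  tens_scaleA tens_scale1 tens_scaleDr tens_scaleDl.

Lemma pureZ m n d : pure m n *r d = pure m (n *r d).
Proof. by rewrite /rmul /GRing.scale /= tens_scaleE. Qed.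

End Tensor.

Section TensorLift.
Variables (B D : nzRingType) (M : lmodType B^c) (N : bimod B D) (G : zmodType).
Variable phi : M -> N -> G.
Hypothesis phiDl : forall m m' n, phi (m + m') n = phi m n + phi m' n.
Hypothesis phiDr : forall m n n', phi m (n + n') = phi m n + phi m n'.
Hypothesis phi_bal : forall m a n, phi (m *r a) n = phi m (lact a n).

Definition tlift (x : tens M N) : G := \sum_(p <- trepr x) phi p.1 p.2.

Lemma tlift_teq (u v : seq (M * N)) :
  teq u v -> \sum_(p <- u) phi p.1 p.2 = \sum_(p <- v) phi p.1 p.2.
Proof.
elim=> {u v} [v|v v' _ <-|v v' v'' _ -> _ <-
  |v v' w w' _ IH1 _ IH2|v w|n|m m' n|m n n'|m a n] //.
- by rewrite !big_cat IH1 IH2.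
- by rewrite !big_cat /= addrC.
- rewrite big_seq1 big_nil /=; apply: (addrI (phi 0 n)).
  by rewrite -phiDl !addr0.
- by rewrite !big_cons !big_nil /= !addr0 phiDl.
- by rewrite !big_cons !big_nil /= !addr0 phiDr.
- by rewrite !big_seq1 /= phi_bal.
Qed.

Lemma tlift_tpi u : tlift (tpi u) = \sum_(p <- u) phi p.1 p.2.
Proof. exact/tlift_teq/trepr_tpi. Qed.

Lemma tlift_pure m n : tlift (pure m n) = phi m n.
Proof. by rewrite tlift_tpi big_seq1. Qed.

Lemma tliftD x y : tlift (x + y) = tlift x + tlift y.
Proof. by rewrite -(treprK x) -(treprK y) -tpiD !tlift_tpi big_cat. Qed.

Lemma tens_ind (Q : tens M N -> Prop) :
  (forall x y, Q x -> Q y -> Q (x + y)) -> (forall m n, Q (pure m n)) ->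
  forall x, Q x.
Proof.
move=> QD Qp x; rewrite -(treprK x); elim: (trepr x) => [|[m n] u IH].
  by rewrite (_ : tpi [::] = pure 0 0) //; apply/tpiP/teq_sym/teq_0.
by rewrite tpi_cons; apply: QD.
Qed.

End TensorLift.

(* A B-D-bimodule with an e-hermitian form for which the two involutions are *)
(* adjoint. Tensoring with it turns hermitian forms over (B, s) into         *)
(* e-hermitian forms over (D, t).                                            *)
Record hbimod (B D : nzRingType) (s : involution B) (t : involution D)
    (e : bool) := HBimod {
  hbcar :> bimod B D;
  bval : hbcar -> hbcar -> D;
  bvalP : is_herm t e bval;
  bval_adj : forall a x y, bval (lact a x) y = bval x (lact (s a) y) }.

Section TensorForm.
Variables (B D : nzRingType) (s : involution B) (t : involution D) (e : bool).
Variables (h : hform s false) (N : hbimod s t e).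
Let hP := hvalP h.
Let bP := bvalP N.

Definition tval_seq (u v : seq (h * N)) : D :=
  \sum_(p <- u) \sum_(q <- v) bval p.2 (lact (hval p.1 q.1) q.2).

Lemma tval_seqC u v : tval_seq v u = (-1) ^+ e * t (tval_seq u v).
Proof.
rewrite /tval_seq exchange_big raddf_sum mulr_sumr /=; apply: eq_bigr => p _.
rewrite raddf_sum mulr_sumr; apply: eq_bigr => q _.
by rewrite (herm_sym hP p.1) expr0 mul1r -bval_adj (herm_sym bP).
Qed.

Lemma herm_rmulr (x y : h) a : hval x (y *r a) = hval x y * a.
Proof. by rewrite -[x in LHS]rmul1 (herm_scale hP) inv_fun1 mul1r. Qed.

Lemma lact0 (B0 D0 : nzRingType) (N0 : bimod B0 D0) a :
  lact a (0 : N0) = 0.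
Proof. by apply: (addrI (lact a (0 : N0))); rewrite -lactDr !addr0. Qed.

Lemma hval0r (x : h) : hval x 0 = 0.
Proof. by apply: (addrI (hval x 0)); rewrite -(herm_addr hP) !addr0. Qed.
Lemma bval0r (x : N) : bval x 0 = 0.
Proof. by apply: (addrI (bval x 0)); rewrite -(herm_addr bP) !addr0. Qed.

Lemma tval_seq_teqr u v v' : teq v v' -> tval_seq u v = tval_seq u v'.
Proof.
move=> vv'; apply: eq_bigr => p _.
elim: vv' => {v v'} [v|v v' _ <-|v v' v'' _ -> _ <-|v v' w w' _ IH1 _ IH2|v w|n
  |m m' n|m n n'|m a n] //.
- by rewrite !big_cat IH1 IH2.
- by rewrite !big_cat /= addrC.
- have lact0l (x : N) : lact 0 x = 0.
    by apply: (addrI (lact 0 x)); rewrite -lactDl !addr0.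
  by rewrite big_cons !big_nil /= hval0r lact0l bval0r addr0.
- by rewrite !big_cons !big_nil /= !addr0 (herm_addr hP) lactDl (herm_addr bP).
- by rewrite !big_cons !big_nil /= !addr0 lactDr (herm_addr bP).
- by rewrite !big_cons !big_nil /= !addr0 herm_rmulr lactM.
Qed.

Lemma tval_seq_teql u u' v : teq u u' -> tval_seq u v = tval_seq u' v.
Proof. by move=> uu'; rewrite 2!(tval_seqC v) (tval_seq_teqr v uu'). Qed.

Definition tval (x y : tens h N) : D := tval_seq (trepr x) (trepr y).

Lemma tval_tpi u v : tval (tpi u) (tpi v) = tval_seq u v.
Proof.
by rewrite /tval (tval_seq_teql _ (trepr_tpi u)) (tval_seq_teqr _ (trepr_tpi v)).
Qed.

Lemma tval_pure m n m' n' :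
  tval (pure m n) (pure m' n') = bval n (lact (hval m m') n').
Proof. by rewrite /pure tval_tpi /tval_seq !big_cons !big_nil !addr0. Qed.

Lemma tval_herm : @is_herm D t e (tens h N) tval.
Proof.
split=> [x x' y|x y y'|x y a b|x y].
- by rewrite -(treprK x) -(treprK x') -(treprK y) -tpiD !tval_tpi /tval_seq big_cat.
- rewrite -(treprK x) -(treprK y) -(treprK y') -tpiD !tval_tpi /tval_seq -big_split.
  by apply: eq_bigr => p _; rewrite big_cat.
- rewrite -(treprK x) -(treprK y) /rmul /GRing.scale /= !tens_scaleE !tval_tpi.
  rewrite /tval_seq /tens_rmul big_map mulr_sumr mulr_suml; apply: eq_bigr => p _.
  rewrite big_map mulr_sumr mulr_suml; apply: eq_bigr => q _ /=.
  by rewrite lactC (herm_scale bP).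
- exact: tval_seqC.
Qed.

Definition tensform : hform t e := HForm tval_herm.

End TensorForm.

(* Extension of scalars along f is the tensor product with B' viewed as a    *)
(* B-B'-bimodule through f, with form (x, y) |-> s' x * y.                   *)
Section ScalarExtension.
Variables (B B' : nzRingType) (s : involution B) (s' : involution B').
Variables (f : {rmorphism B -> B'}) (fs : forall a, f (s a) = s' (f a)).

Definition scal_act (a : B) (x : (B'^c)^o) : (B'^c)^o := (f a : B') * (x : B').

Lemma scal_actP : is_bimod scal_act.
Proof.
split=> [a b x|a x y|a b x|x|a x d]; rewrite /scal_act.
- by rewrite rmorphD mulrDl.
- exact: (@mulrDr B').
- by rewrite rmorphM -mulrA.
- by rewrite rmorph1 mul1r.
- exact: (@mulrA B').
Qed.

Definition scal_bimod : bimod B B' := Bimod scal_actP.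

Definition scal_val (x y : (B'^c)^o) : B' := s' (x : B') * (y : B').

Lemma scal_valP : @is_herm B' s' false (B'^c)^o scal_val.
Proof.
split=> [x x' y|x y y'|x y a b|x y]; rewrite /scal_val.
- by rewrite raddfD mulrDl.
- exact: (@mulrDr B').
- by rewrite -[x *r a]/((x : B') * a) -[y *r b]/((y : B') * b) inv_funM !mulrA.
- by rewrite expr0 mul1r inv_funM inv_funK.
Qed.


Lemma scal_adj a (x y : scal_bimod) :
  scal_val (lact a x) y = scal_val x (lact (s a) y).
Proof. by rewrite /scal_val /= /scal_act inv_funM fs mulrA. Qed.

Definition scal_hbimod : hbimod s s' false :=
  @HBimod B B' s s' false scal_bimod scal_val scal_valP scal_adj.

Definition scalext (h : hform s false) : hform s' false := tensform h scal_hbimod.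

End ScalarExtension.

Definition rrestr (B B' : nzRingType) (f : {rmorphism B -> B'})
  (M : lmodType B'^c) : Type := M.

Section Restriction.
Variables (B B' : nzRingType) (f : {rmorphism B -> B'}) (M : lmodType B'^c).
HB.instance Definition _ := GRing.Zmodule.on (rrestr f M).
Definition rrestr_scale (b : B^c) (x : rrestr f M) : rrestr f M :=
  (x : M) *r f b.
Lemma rrestr_scaleA a b v : rrestr_scale a (rrestr_scale b v) = rrestr_scale (a * b) v.
Proof. by rewrite /rrestr_scale rmulA -rmorphM. Qed.
Lemma rrestr_scale1 : left_id 1 rrestr_scale.
Proof. by move=> v; rewrite /rrestr_scale rmorph1 rmul1. Qed.
Lemma rrestr_scaleDr : right_distributive rrestr_scale +%R.
Proof. by move=> a u v; apply: rmulDl. Qed.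
Lemma rrestr_scaleDl v : {morph rrestr_scale^~ v : a b / a + b}.
Proof. by move=> a b; rewrite /rrestr_scale -rmulDr -rmorphD. Qed.
HB.instance Definition _ := GRing.Zmodule_isLmodule.Build B^c (rrestr f M)
  rrestr_scaleA rrestr_scale1 rrestr_scaleDr rrestr_scaleDl.
End Restriction.

(* A (x)_F K, with K an F-algebra along iota: the coordinates are relative   *)
(* to the basis of A underlying v2r, and the product is given by the         *)
(* structure constants of that basis.                                        *)
Definition ext (F K : fieldType) (A : falgType F) (iota : {rmorphism F -> K}) :
  Type := 'rV[K]_(dim A).

Section ExtOfScalars.
Variables (F K : fieldType) (A : falgType F) (iota : {rmorphism F -> K}).
Local Notation ext := (ext A iota).

HB.instance Definition _ := GRing.Lmodule.on ext.

(* a |-> a (x) 1 *)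
Definition extin (a : A) : ext := map_mx iota (v2r a).
Definition ext_basis (i : 'I_(dim A)) : A := r2v (delta_mx 0 i).
Definition ext_mul (x y : ext) : ext :=
  \sum_i \sum_j (x 0 i * y 0 j) *: extin (ext_basis i * ext_basis j).

Lemma ext_basisE (a : A) : a = \sum_i v2r a 0 i *: ext_basis i.
Proof.
rewrite -[LHS]v2rK [v2r a in LHS]row_sum_delta linear_sum.
by apply: eq_bigr => i _; rewrite linearZ.
Qed.

Lemma extin_additive : zmod_morphism extin.
Proof. by move=> a b; rewrite /extin linearB map_mxB. Qed.
HB.instance Definition _ := GRing.isZmodMorphism.Build A ext extin extin_additive.

Lemma extinZ c a : extin (c *: a) = iota c *: extin a.
Proof. by rewrite /extin linearZ map_mxZ. Qed.

Lemma ext_eqE (x : ext) : x = \sum_i x 0 i *: extin (ext_basis i).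
Proof.
rewrite [LHS]row_sum_delta; apply: eq_bigr => i _.
by rewrite /extin /ext_basis r2vK map_delta_mx.
Qed.

Lemma ext_mulDl : left_distributive ext_mul +%R.
Proof.
move=> x y z; rewrite /ext_mul -big_split; apply: eq_bigr => i _.
by rewrite -big_split; apply: eq_bigr => j _; rewrite mxE mulrDl scalerDl.
Qed.
Lemma ext_mulDr : right_distributive ext_mul +%R.
Proof.
move=> x y z; rewrite /ext_mul -big_split; apply: eq_bigr => i _.
by rewrite -big_split; apply: eq_bigr => j _; rewrite mxE mulrDr scalerDl.
Qed.
Lemma ext_mulZl c x y : ext_mul (c *: x) y = c *: ext_mul x y.
Proof.
rewrite /ext_mul scaler_sumr; apply: eq_bigr => i _.
by rewrite scaler_sumr; apply: eq_bigr => j _; rewrite mxE scalerA mulrA.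
Qed.
Lemma ext_mulZr c x y : ext_mul x (c *: y) = c *: ext_mul x y.
Proof.
rewrite /ext_mul scaler_sumr; apply: eq_bigr => i _.
by rewrite scaler_sumr; apply: eq_bigr => j _; rewrite mxE scalerA mulrCA.
Qed.

Lemma ext_mul_suml I r (Q : pred I) (f : I -> ext) y :
  ext_mul (\sum_(i <- r | Q i) f i) y = \sum_(i <- r | Q i) ext_mul (f i) y.
Proof.
apply: (big_morph (ext_mul^~ y)) => [x x'|]; first exact: ext_mulDl.
by rewrite -(scale0r (0 : ext)) ext_mulZl !scale0r.
Qed.
Lemma ext_mul_sumr I r (Q : pred I) (f : I -> ext) x :
  ext_mul x (\sum_(i <- r | Q i) f i) = \sum_(i <- r | Q i) ext_mul x (f i).
Proof.
apply: (big_morph (ext_mul x)) => [y y'|]; first exact: ext_mulDr.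
by rewrite -(scale0r (0 : ext)) ext_mulZr !scale0r.
Qed.

Lemma extinM a b : extin (a * b) = ext_mul (extin a) (extin b).
Proof.
rewrite {1}(ext_basisE a) {1}(ext_basisE b) mulr_suml raddf_sum.
apply: eq_bigr => i _; rewrite mulr_sumr raddf_sum; apply: eq_bigr => j _.
by rewrite -scalerAl -scalerAr scalerA /= extinZ rmorphM !mxE.
Qed.

(* Multilinear identities need only be checked on pure tensors. *)
Lemma ext_ind (Q : ext -> Prop) :
  (forall x y, Q x -> Q y -> Q (x + y)) -> Q 0 ->
  (forall c a, Q (c *: extin a)) -> forall x, Q x.
Proof. by move=> QD Q0 Qp x; rewrite (ext_eqE x); apply: big_ind. Qed.

Lemma ext_mul0l x : ext_mul 0 x = 0.
Proof. by apply: (addrI (ext_mul 0 x)); rewrite -ext_mulDl !addr0. Qed.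
Lemma ext_mul0r x : ext_mul x 0 = 0.
Proof. by apply: (addrI (ext_mul x 0)); rewrite -ext_mulDr !addr0. Qed.

Lemma ext_mulA : associative ext_mul.
Proof.
move=> x y z.
elim/ext_ind: x => [x x' IH IH'||c a]; first by rewrite !ext_mulDl IH IH'.
  by rewrite !ext_mul0l.
elim/ext_ind: y => [y y' IH IH'||d b].
- by rewrite !(ext_mulDl, ext_mulDr) IH IH'.
- by rewrite !(ext_mul0l, ext_mul0r).
elim/ext_ind: z => [z z' IH IH'||e g]; first by rewrite !ext_mulDr IH IH'.
  by rewrite !ext_mul0r.
by rewrite !(ext_mulZl, ext_mulZr) -!extinM mulrA !scalerA; congr (_ *: _); ring.
Qed.
Lemma ext_mul1l : left_id (extin 1) ext_mul.
Proof.
elim/ext_ind => [x x' IH IH'||c a]; first by rewrite ext_mulDr IH IH'.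
  by rewrite ext_mul0r.
by rewrite ext_mulZr -extinM mul1r.
Qed.
Lemma ext_mul1r : right_id (extin 1) ext_mul.
Proof.
elim/ext_ind => [x x' IH IH'||c a]; first by rewrite ext_mulDl IH IH'.
  by rewrite ext_mul0l.
by rewrite ext_mulZl -extinM mulr1.
Qed.
Lemma extin_inj : injective extin.
Proof. by move=> a b /map_mx_inj /(can_inj v2rK). Qed.
Lemma ext_oner_neq0 : extin 1 != 0.
Proof. by rewrite -(raddf0 extin) (inj_eq extin_inj) oner_neq0. Qed.

HB.instance Definition _ := GRing.Zmodule_isNzRing.Build ext
  ext_mulA ext_mul1l ext_mul1r ext_mulDl ext_mulDr ext_oner_neq0.

Lemma ext_scaleAl c (x y : ext) : c *: (x * y) = (c *: x) * y.
Proof. by rewrite /GRing.mul /= ext_mulZl. Qed.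
Lemma ext_scaleAr c (x y : ext) : c *: (x * y) = x * (c *: y).
Proof. by rewrite /GRing.mul /= ext_mulZr. Qed.
HB.instance Definition _ := GRing.Lmodule_isLalgebra.Build K ext ext_scaleAl.
HB.instance Definition _ := GRing.Lalgebra_isAlgebra.Build K ext ext_scaleAr.

Lemma extin_monoid : monoid_morphism extin.
Proof. by split=> // a b; rewrite extinM. Qed.
HB.instance Definition _ := GRing.isMonoidMorphism.Build A ext extin extin_monoid.

End ExtOfScalars.

Record alg_involution (F : fieldType) (A : falgType F) := AlgInvolution {
  ainv_fun :> involution A;
  ainv_funZ : scalable ainv_fun }.

Section ExtInvolution.
Variables (F K : fieldType) (A : falgType F) (iota : {rmorphism F -> K}).
Variable sigma : alg_involution A.

(* sigma (x) id *)
Definition ext_inv_fun (x : ext A iota) : ext A iota :=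
  \sum_i x 0 i *: extin iota (sigma (ext_basis i)).

Lemma ext_inv_linear : linear ext_inv_fun.
Proof.
move=> c x y; rewrite /ext_inv_fun scaler_sumr -big_split.
by apply: eq_bigr => i _; rewrite !mxE scalerDl scalerA.
Qed.
HB.instance Definition _ :=
  GRing.isLinear.Build K (ext A iota) (ext A iota) *:%R ext_inv_fun ext_inv_linear.

Lemma ext_inv_extin a : ext_inv_fun (extin iota a) = extin iota (sigma a).
Proof.
rewrite [in RHS](ext_basisE a) !raddf_sum; apply: eq_bigr => i _ /=.
by rewrite ainv_funZ /= extinZ mxE.
Qed.

Lemma ext_inv_funM x y : ext_inv_fun (x * y) = ext_inv_fun y * ext_inv_fun x.
Proof.
elim/ext_ind: x => [x x' IH IH'||c a].
- by rewrite mulrDl !raddfD /= IH IH' mulrDr.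
- by rewrite mul0r !raddf0 mulr0.
elim/ext_ind: y => [y y' IH IH'||d b].
- by rewrite mulrDr !raddfD /= IH IH' mulrDl.
- by rewrite mulr0 !raddf0 mul0r.
rewrite -scalerAl -scalerAr -rmorphM /= !linearZ /= !ext_inv_extin inv_funM rmorphM.
by rewrite -scalerAl -scalerAr !scalerA mulrC.
Qed.

Lemma ext_inv_funK : involutive ext_inv_fun.
Proof.
elim/ext_ind => [x x' IH IH'||c a]; first by rewrite !raddfD /= IH IH'.
- by rewrite !raddf0.
- by rewrite !linearZ /= !ext_inv_extin inv_funK.
Qed.

Definition ext_inv : involution (ext A iota) :=
  @Involution (ext A iota) ext_inv_fun ext_inv_funM ext_inv_funK.

End ExtInvolution.

Section ExtMap.
Variables (F K K' : fieldType) (A : falgType F).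
Variables (iota : {rmorphism F -> K}) (iota' : {rmorphism F -> K'}).
Variables (rho : {rmorphism K -> K'}) (Erho : forall c, rho (iota c) = iota' c).

(* id (x) rho *)
Definition extmap of (forall c, rho (iota c) = iota' c) :
  ext A iota -> ext A iota' := fun x => map_mx rho x.
Local Notation f := (extmap Erho).

Lemma extmap_additive : zmod_morphism f.
Proof. exact: map_mxB. Qed.
HB.instance Definition _ :=
  GRing.isZmodMorphism.Build (ext A iota) (ext A iota') f extmap_additive.

Lemma extmapZ c x : f (c *: x) = rho c *: f x.
Proof. exact: map_mxZ. Qed.
Lemma extmap_extin a : f (extin iota a) = extin iota' a.
Proof. by apply/rowP => j; rewrite !mxE Erho. Qed.

Lemma extmap_monoid : monoid_morphism f.
Proof.
split; first by rewrite extmap_extin.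
move=> x y; elim/ext_ind: x => [x x' IH IH'||c a].
- by rewrite mulrDl !raddfD /= IH IH' mulrDl.
- by rewrite mul0r !raddf0 mul0r.
elim/ext_ind: y => [y y' IH IH'||d b].
- by rewrite mulrDr !raddfD /= IH IH' mulrDr.
- by rewrite mulr0 !raddf0 mulr0.
rewrite -scalerAl -scalerAr -rmorphM /= !extmapZ !extmap_extin.
by rewrite -scalerAl -scalerAr rmorphM.
Qed.
HB.instance Definition _ :=
  GRing.isMonoidMorphism.Build (ext A iota) (ext A iota') f extmap_monoid.

Lemma extmap_inv (sigma : alg_involution A) x :
  f (ext_inv iota sigma x) = ext_inv iota' sigma (f x).
Proof.
rewrite -[ext_inv _ _ x]/(ext_inv_fun sigma x) -[RHS]/(ext_inv_fun sigma (f x)).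
rewrite /ext_inv_fun raddf_sum; apply: eq_bigr => i _.
by rewrite /= extmapZ extmap_extin mxE.
Qed.
End ExtMap.

Section Transfer.
Variables (F : fieldType) (L : fieldExtType F).

(* Tr_{L/F}: the trace of the matrix of multiplication by x in a basis. *)
Definition field_trace (x : L) : F := \tr (lin1_mx (v2r \o *%R x \o r2v)).

Lemma field_traceD x y : field_trace (x + y) = field_trace x + field_trace y.
Proof.
rewrite /field_trace -raddfD; congr (\tr _); apply/matrixP => i j.
by rewrite !mxE /= mulrDl linearD mxE.
Qed.
Lemma field_trace0 : field_trace 0 = 0.
Proof. by apply: (addrI (field_trace 0)); rewrite -field_traceD !addr0. Qed.
Lemma field_traceZ c x : field_trace (c *: x) = c * field_trace x.
Proof.
rewrite /field_trace -linearZ; congr (\tr _); apply/matrixP => i j.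
by rewrite !mxE /= -scalerAl linearZ mxE.
Qed.

Variables (A : falgType F) (sigma : alg_involution A).
Local Notation AL := (ext A (in_alg L)).
Local Notation j := (extin (in_alg L)).

(* id_A (x) Tr_{L/F} *)
Definition ext_trace (x : AL) : A := r2v (map_mx field_trace x).

Lemma ext_traceD x y : ext_trace (x + y) = ext_trace x + ext_trace y.
Proof.
rewrite /ext_trace -linearD; congr r2v.
by apply/rowP => i; rewrite !mxE field_traceD.
Qed.
Lemma ext_trace0 : ext_trace 0 = 0.
Proof. by apply: (addrI (ext_trace 0)); rewrite -ext_traceD !addr0. Qed.
Lemma ext_trace_pure c a : ext_trace (c *: j a) = field_trace c *: a.
Proof.
rewrite /ext_trace -[in RHS](v2rK a) -linearZ; congr r2v.
by apply/rowP => i; rewrite !mxE /= mulrC -scalerAl mul1r field_traceZ mulrC.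
Qed.

Lemma ext_traceMl a x : ext_trace (j a * x) = a * ext_trace x.
Proof.
elim/ext_ind: x => [x x' IH IH'||c b].
- by rewrite mulrDr !ext_traceD IH IH' mulrDr.
- by rewrite mulr0 ext_trace0 mulr0.
- by rewrite -scalerAr -rmorphM !ext_trace_pure scalerAr.
Qed.
Lemma ext_traceMr a x : ext_trace (x * j a) = ext_trace x * a.
Proof.
elim/ext_ind: x => [x x' IH IH'||c b].
- by rewrite mulrDl !ext_traceD IH IH' mulrDl.
- by rewrite mul0r ext_trace0 mul0r.
- by rewrite -scalerAl -rmorphM !ext_trace_pure scalerAl.
Qed.
Lemma ext_trace_inv x :
  ext_trace (ext_inv (in_alg L) sigma x) = sigma (ext_trace x).
Proof.
elim/ext_ind: x => [x x' IH IH'||c b].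
- by rewrite raddfD !ext_traceD IH IH' raddfD.
- by rewrite !(raddf0, ext_trace0).
rewrite -[ext_inv _ _ _]/(ext_inv_fun sigma (c *: j b)) linearZ /=.
by rewrite ext_inv_extin !ext_trace_pure ainv_funZ.
Qed.

Variable h : hform (ext_inv (in_alg L) sigma) false.

Definition transfer_val (x y : rrestr (extin (in_alg L) : {rmorphism A -> AL}) h) : A :=
  ext_trace (hval (x : h) (y : h)).

Lemma transfer_valP : is_herm sigma false transfer_val.
Proof.
have hP := hvalP h; rewrite /transfer_val; split=> [x x' y|x y y'|x y a b|x y].
- by rewrite (herm_addl hP) ext_traceD.
- by rewrite (herm_addr hP) ext_traceD.
- rewrite -[x *r a]/((x : h) *r j a) -[y *r b]/((y : h) *r j b) (herm_scale hP).
  rewrite ext_traceMr -[_ (j a)]/(ext_inv_fun sigma (j a)) ext_inv_extin.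
  by rewrite ext_traceMl.
- by rewrite (herm_sym hP) !expr0 !mul1r ext_trace_inv.
Qed.

Definition transfer : hform sigma false := HForm transfer_valP.

End Transfer.

Section Quaternion.
Variable K : fieldType.

(* H_K = (-1,-1)_K: Quat a b c d is a + b i + c j + d k with                 *)
(* i^2 = j^2 = -1 and k = i j = - j i.                                       *)
Record quat := Quat { qre : K; qi : K; qj : K; qk : K }.

Definition quat_tuple (x : quat) := (qre x, qi x, qj x, qk x).
Definition tuple_quat (t : K * K * K * K) :=
  let: (a, b, c, d) := t in Quat a b c d.
Lemma quat_tupleK : cancel quat_tuple tuple_quat. Proof. by case. Qed.
HB.instance Definition _ := Equality.copy quat (can_type quat_tupleK).
HB.instance Definition _ := Choice.copy quat (can_type quat_tupleK).

Definition quat_add x y :=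
  Quat (qre x + qre y) (qi x + qi y) (qj x + qj y) (qk x + qk y).
Definition quat_opp x := Quat (- qre x) (- qi x) (- qj x) (- qk x).
Definition quat_mul x y := Quat
  (qre x * qre y - qi x * qi y - qj x * qj y - qk x * qk y)
  (qre x * qi y + qi x * qre y + qj x * qk y - qk x * qj y)
  (qre x * qj y - qi x * qk y + qj x * qre y + qk x * qi y)
  (qre x * qk y + qi x * qj y - qj x * qi y + qk x * qre y).
Definition quat_const c := Quat c 0 0 0.
Definition quat_conj x := Quat (qre x) (- qi x) (- qj x) (- qk x).

Ltac quat_ring := repeat case=> ? ? ? ?; congr Quat => /=; ring.

Lemma quat_addA : associative quat_add. Proof. quat_ring. Qed.
Lemma quat_addC : commutative quat_add. Proof. quat_ring. Qed.
Lemma quat_add0 : left_id (quat_const 0) quat_add. Proof. quat_ring. Qed.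
Lemma quat_addN : left_inverse (quat_const 0) quat_opp quat_add.
Proof. quat_ring. Qed.
HB.instance Definition _ :=
  GRing.isZmodule.Build quat quat_addA quat_addC quat_add0 quat_addN.

Lemma quat_mulA : associative quat_mul. Proof. quat_ring. Qed.
Lemma quat_mul1l : left_id (quat_const 1) quat_mul. Proof. quat_ring. Qed.
Lemma quat_mul1r : right_id (quat_const 1) quat_mul. Proof. quat_ring. Qed.
Lemma quat_mulDl : left_distributive quat_mul quat_add. Proof. quat_ring. Qed.
Lemma quat_mulDr : right_distributive quat_mul quat_add. Proof. quat_ring. Qed.
Lemma quat_oner_neq0 : quat_const 1 != 0.
Proof. by apply/eqP => -[] /eqP; rewrite oner_eq0. Qed.
HB.instance Definition _ := GRing.Zmodule_isNzRing.Build quat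
  quat_mulA quat_mul1l quat_mul1r quat_mulDl quat_mulDr quat_oner_neq0.

Lemma quat_conj_additive : zmod_morphism quat_conj. Proof. quat_ring. Qed.
HB.instance Definition _ :=
  GRing.isZmodMorphism.Build quat quat quat_conj quat_conj_additive.
Lemma quat_conjM x y : quat_conj (x * y) = quat_conj y * quat_conj x.
Proof. by case: x y => ? ? ? ? [? ? ? ?]; congr Quat => /=; ring. Qed.
Lemma quat_conjK : involutive quat_conj. Proof. quat_ring. Qed.
Definition quat_inv : involution quat :=
  @Involution quat quat_conj quat_conjM quat_conjK.

End Quaternion.

Section QuatMap.
Variables (K K' : fieldType) (rho : {rmorphism K -> K'}).
Definition quat_map (x : quat K) : quat K' :=
  Quat (rho (qre x)) (rho (qi x)) (rho (qj x)) (rho (qk x)).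
Lemma quat_map_additive : zmod_morphism quat_map.
Proof. by case=> ? ? ? ? [? ? ? ?]; congr Quat; rewrite /= rmorphB. Qed.
HB.instance Definition _ :=
  GRing.isZmodMorphism.Build (quat K) (quat K') quat_map quat_map_additive.
Lemma quat_map_monoid : monoid_morphism quat_map.
Proof.
split=> [|[? ? ? ?] [? ? ? ?]]; first by congr Quat; rewrite ?rmorph1 ?rmorph0.
by congr Quat; rewrite /= !(rmorphM, rmorphD, rmorphN).
Qed.
HB.instance Definition _ :=
  GRing.isMonoidMorphism.Build (quat K) (quat K') quat_map quat_map_monoid.
End QuatMap.

Section ComplexMap.
Local Open Scope complex_scope.

Section Conj.
Variable K : fieldType.
Definition cconj (x : K[i]) : K[i] := let: a +i* b := x in a +i* (- b).
Lemma cconj_additive : zmod_morphism cconj.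
Proof. by case=> a b [c d]; congr Complex => /=; ring. Qed.
HB.instance Definition _ := GRing.isZmodMorphism.Build K[i] K[i] cconj cconj_additive.
Lemma cconjM (x y : K[i]) : cconj (x * y) = cconj y * cconj x.
Proof. by case: x y => a b [c d]; congr Complex => /=; ring. Qed.
Lemma cconjK : involutive cconj.
Proof. by case=> a b; rewrite /= opprK. Qed.
Definition complex_inv : involution K[i] := @Involution K[i] cconj cconjM cconjK.
End Conj.

Variables (K K' : fieldType) (rho : {rmorphism K -> K'}).
Definition complex_map (x : K[i]) : K'[i] := let: a +i* b := x in rho a +i* rho b.
Lemma complex_map_additive : zmod_morphism complex_map.
Proof. by case=> a b [c d]; congr Complex; rewrite rmorphB. Qed.
HB.instance Definition _ :=
  GRing.isZmodMorphism.Build K[i] K'[i] complex_map complex_map_additive.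
Lemma complex_map_monoid : monoid_morphism complex_map.
Proof.
split=> [|[a b] [c d]]; first by congr Complex; rewrite ?rmorph1 ?rmorph0.
by congr Complex; rewrite !(rmorphM, rmorphD, rmorphN).
Qed.
HB.instance Definition _ :=
  GRing.isMonoidMorphism.Build K[i] K'[i] complex_map complex_map_monoid.
End ComplexMap.

Section Exchange.
Variable K : fieldType.
Definition exch_fun (x : (K * K)%type) : (K * K)%type := (x.2, x.1).
Lemma exch_additive : zmod_morphism exch_fun. Proof. by []. Qed.
HB.instance Definition _ :=
  GRing.isZmodMorphism.Build (K * K)%type (K * K)%type exch_fun exch_additive.
Lemma exchM (x y : (K * K)%type) : exch_fun (x * y) = exch_fun y * exch_fun x.
Proof. by congr (_, _); rewrite mulrC. Qed.
Lemma exchK : involutive exch_fun. Proof. by case. Qed.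
Definition exch_inv : involution (K * K)%type :=
  @Involution (K * K)%type exch_fun exchM exchK.

Definition id_inv : involution K :=
  @Involution K idfun (fun x y => mulrC x y) (fun x => erefl x).
End Exchange.

Section PairMap.
Variables (K K' : fieldType) (rho : {rmorphism K -> K'}).
Definition pair_map (x : (K * K)%type) : (K' * K')%type := (rho x.1, rho x.2).
Lemma pair_map_additive : zmod_morphism pair_map.
Proof. by move=> x y; congr (_, _); apply: rmorphB. Qed.
HB.instance Definition _ :=
  GRing.isZmodMorphism.Build (K * K)%type (K' * K')%type pair_map pair_map_additive.
Lemma pair_map_monoid : monoid_morphism pair_map.
Proof.
by split=> [|x y]; congr (_, _); rewrite ?rmorph1 ?rmorphM.
Qed.
HB.instance Definition _ :=
  GRing.isMonoidMorphism.Build (K * K)%type (K' * K')%type pair_map pair_map_monoid.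
End PairMap.

Inductive kind := DSplit | DQuat | DComplex | DExch.

Definition Dring (k : kind) (K : fieldType) : nzRingType :=
  match k with
  | DSplit => K
  | DQuat => quat K
  | DComplex => K[i]%C
  | DExch => (K * K)%type
  end.

Definition Dinv (k : kind) (K : fieldType) : involution (Dring k K) :=
  match k return involution (Dring k K) with
  | DSplit => id_inv K
  | DQuat => quat_inv K
  | DComplex => complex_inv K
  | DExch => exch_inv K
  end.

Definition Dconst (k : kind) (K : fieldType) : K -> Dring k K :=
  match k return K -> Dring k K with
  | DSplit => fun c => c
  | DQuat => fun c => Quat c 0 0 0
  | DComplex => fun c => (c +i* 0)%C
  | DExch => fun c => (c, c)
  end.

Definition Dmap (k : kind) (K K' : fieldType) (rho : {rmorphism K -> K'}) :
    {rmorphism Dring k K -> Dring k K'} :=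
  match k return {rmorphism Dring k K -> Dring k K'} with
  | DSplit => rho
  | DQuat => quat_map rho
  | DComplex => complex_map rho
  | DExch => pair_map rho
  end.

(* The entries of the diagonal form are (-1) ^+ a i.                         *)
Definition diagonalizes (D : nzRingType) (t : involution D)
    (h : hform t false) (n : nat) (a : 'I_n -> bool) : Prop :=
  exists v : 'I_n -> h,
    (forall x, exists! c : {ffun 'I_n -> D}, x = \sum_i v i *r c i) /\
    (forall i j, hval (v i) (v j) = if i == j then (-1) ^+ a i else 0).

Definition diag_sign (D : nzRingType) (t : involution D) (h : hform t false) :
    int :=
  xget 0 [set z | exists n (a : 'I_n -> bool),
                    diagonalizes h a /\ z = \sum_i (-1) ^+ a i]%classic.

(* Skew-hermitian forms over (K(sqrt -1), -) do not occur as values of the   *)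
(* Morita equivalences below, since epsilon_P = 1 in the unitary case.       *)
Definition sign (k : kind) (K : fieldType) (e : bool) :
    hform (Dinv k K) e -> int :=
  match k, e return hform (Dinv k K) e -> int with
  | DExch, _ => fun=> 0
  | _, true => fun=> 0
  | _, false => fun h => diag_sign h
  end.

Definition is_generator (D : nzRingType) (N : lmodType D^c) : Prop :=
  exists n (f : 'I_n -> {linear N -> (D^c)^o}) (x : 'I_n -> N),
    \sum_i f i (x i) = 1 :> D.

(* Hermitian Morita theory: an equivalence from hermitian forms over (B, s)  *)
(* to e-hermitian forms over (D, theta) is tensoring with an invertible      *)
(* K-linear B-D-bimodule (a progenerator over D whose endomorphism ring is   *)
(* B) that carries a nonsingular e-hermitian form with adjoint involution s. *)
Record morita (K : fieldType) (B : lalgType K) (s : involution B)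
    (k : kind) (e : bool) := Morita {
  mor_bimod :> hbimod s (Dinv k K) e;
  mor_lin : forall (c : K) (x : hbcar mor_bimod), lact c%:A x = x *r Dconst k c;
  mor_fgproj : fg_projective (hbcar mor_bimod);
  mor_gen : is_generator (hbcar mor_bimod);
  mor_end : forall f : {linear hbcar mor_bimod -> hbcar mor_bimod},
    exists! a : B, forall x, f x = lact a x;
  mor_nonsing : nonsingular (@bval _ _ _ _ _ mor_bimod) }.

(* M (h (x) B), for B an extension of scalars of B0 along f. *)
Definition msign (K : fieldType) (B0 : nzRingType) (s0 : involution B0)
    (B : lalgType K) (s : involution B) (f : {rmorphism B0 -> B})
    (fs : forall a, f (s0 a) = s (f a)) (k : kind) (e : bool)
    (M : morita s k e) (h : hform s0 false) : int :=
  sign (tensform (scalext fs h) M).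

Section InverseIso.
Variables (K K' : fieldType) (rho : {rmorphism K -> K'}).

Lemma bij_ex (b : bijective rho) y : exists x, rho x == y.
Proof. by case: b => g _ gK; exists (g y); rewrite gK. Qed.
Definition iso_inv (b : bijective rho) (y : K') : K := xchoose (bij_ex b y).
Variable b : bijective rho.
Lemma iso_invK : cancel (iso_inv b) rho.
Proof. by move=> y; apply/eqP; exact: (xchooseP (bij_ex b y)). Qed.
Lemma iso_invK' : cancel rho (iso_inv b).
Proof. by move=> x; apply: (bij_inj b); rewrite iso_invK. Qed.
Lemma iso_inv_additive : zmod_morphism (iso_inv b).
Proof. by move=> x y; apply: (bij_inj b); rewrite rmorphB !iso_invK. Qed.
HB.instance Definition _ :=
  GRing.isZmodMorphism.Build K' K (iso_inv b) iso_inv_additive.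
Lemma iso_inv_monoid : monoid_morphism (iso_inv b).
Proof.
by split=> [|x y]; apply: (bij_inj b); rewrite ?rmorphM !iso_invK ?rmorph1.
Qed.
HB.instance Definition _ :=
  GRing.isMonoidMorphism.Build K' K (iso_inv b) iso_inv_monoid.
End InverseIso.

Section DmapTheory.
Variables (k : kind) (K K' : fieldType).
Variables (rho : {rmorphism K -> K'}) (rho' : {rmorphism K' -> K}).
Lemma Dmap_can : cancel rho rho' -> cancel (Dmap k rho) (Dmap k rho').
Proof.
move=> rK; case: k => /=; first exact: rK.
- by case=> a b c d; congr Quat; rewrite /= rK.
- by case=> a b; congr complex.Complex; rewrite /= rK.
- by case=> a b; congr (_, _); rewrite /= rK.
Qed.
Lemma Dmap_inv d : Dmap k rho (Dinv k K d) = Dinv k K' (Dmap k rho d).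
Proof.
case: k d => //=.
- by case=> a b c d; congr Quat; rewrite /= rmorphN.
- by case=> a b; congr complex.Complex; rewrite /= rmorphN.
Qed.
Lemma Dmap_const c : Dmap k rho (Dconst k c) = Dconst k (rho c).
Proof. by case: k => //=; [congr Quat|congr complex.Complex]; rewrite /= rmorph0. Qed.
End DmapTheory.

Section Transport.
Variables (K K' : fieldType) (B : lalgType K) (B' : lalgType K').
Variables (s : involution B) (s' : involution B') (k : kind) (e : bool).
Variables (rho : {rmorphism K -> K'}) (rho' : {rmorphism K' -> K}).
Variables (rK : cancel rho rho') (rK' : cancel rho' rho).
Variables (f' : {rmorphism B' -> B}) (fbij : bijective f').
Hypothesis fZ : forall c, f' c%:A = (rho' c)%:A.
Hypothesis fs : forall a, f' (s' a) = s (f' a).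
Variable M : morita s k e.

Local Notation D := (Dring k K).
Local Notation D' := (Dring k K').
Local Notation g := (Dmap k rho).
Local Notation g' := (Dmap k rho').
Local Notation N := (hbcar M).
Local Notation N' := (rrestr g' N).
Let gK : cancel g g' := @Dmap_can k K K' rho rho' rK.
Let gK' : cancel g' g := @Dmap_can k K' K rho' rho rK'.

Lemma trN_rmul (x : N') d : x *r d = (x : N) *r g' d.
Proof. by []. Qed.

Definition tr_act (a : B') (x : N') : N' := lact (f' a) (x : N).

Lemma tr_actP : is_bimod tr_act.
Proof.
split=> [a b x|a x y|a b x|x|a x d]; rewrite /tr_act.
- by rewrite rmorphD lactDl.
- exact: lactDr.
- by rewrite rmorphM lactM.
- by rewrite rmorph1 lact1.
- exact: lactC.
Qed.
Definition tr_bimod : bimod B' D' := Bimod tr_actP.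

Definition tr_val (x y : N') : D' := g (bval (x : N) (y : N)).

Lemma tr_valP : is_herm (Dinv k K') e tr_val.
Proof.
have bP := bvalP M; rewrite /tr_val; split=> [x x' y|x y y'|x y a b|x y].
- by rewrite (herm_addl bP) rmorphD.
- by rewrite (herm_addr bP) rmorphD.
- by rewrite !trN_rmul (herm_scale bP) !rmorphM /= Dmap_inv !gK'.
- by rewrite (herm_sym bP) rmorphM rmorph_sign /= Dmap_inv.
Qed.

Lemma tr_adj a (x y : tr_bimod) :
  tr_val (lact a x) y = tr_val x (lact (s' a) y).
Proof. by rewrite /tr_val /= /tr_act bval_adj fs. Qed.

Definition tr_hbimod : hbimod s' (Dinv k K') e :=
  @HBimod B' D' s' _ e tr_bimod tr_val tr_valP tr_adj.

Lemma tr_lin c (x : hbcar tr_hbimod) : lact c%:A x = x *r Dconst k c.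
Proof. by rewrite /= /tr_act fZ mor_lin trN_rmul Dmap_const. Qed.

Lemma tr_fgproj : fg_projective (hbcar tr_hbimod).
Proof.
have [n [i [p ipK]]] := mor_fgproj M.
pose i' (x : N') : 'rV[D'^c]_n := \row_j g (i x 0 j : D).
pose q (v : 'rV[D'^c]_n) : 'rV[D^c]_n := \row_j g' (v 0 j : D').
pose p' (v : 'rV[D'^c]_n) : N' := p (q v).
have li : linear i'.
  move=> c x y; apply/rowP => j; rewrite !mxE.
  rewrite -[c *: x + y]/((g' c : D^c) *: (x : N) + (y : N)) linearP !mxE rmorphD.
  by congr (_ + _); rewrite -[_ * i x 0 j]/((i x 0 j : D) * g' c) rmorphM /= gK'.
have lp : linear p'.
  move=> c x y.
  rewrite /p'; have -> : q (c *: x + y) = (g' c : D^c) *: q x + q y; last exact: linearP.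
  apply/rowP => j; rewrite !mxE rmorphD; congr (_ + _).
  by rewrite -[c * x 0 j]/((x 0 j : D') * c) rmorphM.
pose I : {linear N' -> 'rV[D'^c]_n} := HB.pack i' (GRing.isLinear.Build _ _ _ _ i' li).
pose P : {linear 'rV[D'^c]_n -> N'} := HB.pack p' (GRing.isLinear.Build _ _ _ _ p' lp).
exists n, I, P => x; rewrite /= /p' -[RHS]ipK; congr (p _); rewrite /q.
by apply/rowP => j; rewrite !mxE gK.
Qed.

Lemma tr_dual (u : {linear N -> (D^c)^o}) :
  exists u' : {linear N' -> (D'^c)^o}, forall x, u' x = g (u x).
Proof.
pose u' (x : N') : (D'^c)^o := g (u x).
have lu : linear u'.
  move=> c x y; rewrite /u' -[c *: x + y]/((g' c : D^c) *: (x : N) + (y : N)).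
  rewrite linearP rmorphD; congr (_ + _).
  by rewrite -[_ *: u x]/((u x : D) * g' c) rmorphM /= gK'.
pose U : {linear N' -> (D'^c)^o} := HB.pack u' (GRing.isLinear.Build _ _ _ _ u' lu).
by exists U.
Qed.

Lemma tr_gen : is_generator (hbcar tr_hbimod).
Proof.
have [n [u [x ux]]] := mor_gen M.
have /choice[u' u'E] := fun i => tr_dual (u i).
exists n, u', x; rewrite -(rmorph1 g) -ux rmorph_sum.
by apply: eq_bigr => i _; exact: u'E.
Qed.

Lemma tr_end (u : {linear hbcar tr_hbimod -> hbcar tr_hbimod}) :
  exists! a : B', forall x, u x = lact a x.
Proof.
pose v (x : N) : N := u x.
have lv : linear v.
  move=> c x y; rewrite /v -[c]gK.
  exact: (linearP u (g c : D'^c) x y).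
pose V : {linear N -> N} := HB.pack v (GRing.isLinear.Build _ _ _ _ v lv).
have [a [aE aU]] := mor_end V.
have [f fK fK'] := fbij.
exists (f a); split=> [x|a' a'E]; first by rewrite /= /tr_act fK' -aE.
by rewrite (aU (f' a')) ?fK.
Qed.

Lemma tr_nonsing : nonsingular (@bval _ _ _ _ _ tr_hbimod).
Proof.
move=> u; pose v (x : N) : (D^c)^o := g' (u x).
have lv : linear v.
  move=> c x y; rewrite /v -[c in LHS]gK.
  have := linearP u (g c : D'^c) x y.
  rewrite -[_ *: x + y]/((g' (g c) : D^c) *: (x : N) + (y : N)) => ->.
  rewrite rmorphD; congr (_ + _).
  by rewrite -[_ *: u x]/((u x : D') * g c) rmorphM /= gK.
pose V : {linear N -> (D^c)^o} := HB.pack v (GRing.isLinear.Build _ _ _ _ v lv).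
have [x [xE xU]] := mor_nonsing V.
exists x; split=> [y|y yE].
  by rewrite /= /tr_val -[LHS]gK'; congr (g _); exact: xE.
by apply: xU => z; rewrite /= /v yE gK.
Qed.

Definition tr_morita : morita s' k e :=
  @Morita K' B' s' k e tr_hbimod tr_lin tr_fgproj tr_gen tr_end tr_nonsing.

End Transport.

Section TransportCommutes.
Variables (K K' : fieldType) (B : lalgType K) (B' : lalgType K').
Variables (s : involution B) (s' : involution B') (k : kind) (e : bool).
Variables (rho : {rmorphism K -> K'}) (rho' : {rmorphism K' -> K}).
Variables (rK : cancel rho rho') (rK' : cancel rho' rho).
Variables (f : {rmorphism B -> B'}) (f' : {rmorphism B' -> B}).
Variables (fK : cancel f f') (fbij : bijective f').
Hypothesis fZ : forall c, f' c%:A = (rho' c)%:A.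
Hypothesis fs : forall a, f (s a) = s' (f a).
Hypothesis fs' : forall a, f' (s' a) = s (f' a).
Variables (M : morita s k e) (h : hform s false).

Local Notation M' := (tr_morita rK rK' fbij fZ fs' M).
Local Notation N := (hbcar M).
Local Notation N' := (hbcar M').
Local Notation h' := (scalext fs h).
Local Notation hB' := (scal_bimod f).

Let phi (m : h) (n : N) : tens h' N' :=
  pure (pure (N := hB') m 1 : h') (n : N').
Let phiDl m m' n : phi (m + m') n = phi m n + phi m' n.
Proof. by rewrite /phi -pureDl -(pureDl (N := hB')). Qed.
Let phiDr m n n' : phi m (n + n') = phi m n + phi m n'.
Proof. exact: (pureDr (N := tr_bimod rho' f' M)). Qed.
Let phi_bal m a n : phi (m *r a) n = phi m (lact a n).
Proof.
rewrite /phi -[in RHS](fK a) -[lact _ _ in RHS]/(lact (f a) (n : N')).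
rewrite -pure_bal; congr (pure _ _).
rewrite (pureZ (N := hB')) (pure_bal (N := hB')); congr (pure _ _).
by rewrite -[1 *r f a]/((1 : B') * f a) mul1r /= /scal_act mulr1.
Qed.

Let chi (n : N) (m : h) (b : hB') : tens h N := pure m (lact (f' b) n).
Let chiDl n m m' b : chi n (m + m') b = chi n m b + chi n m' b.
Proof. exact: pureDl. Qed.
Let chiDr n m b b' : chi n m (b + b') = chi n m b + chi n m b'.
Proof. by rewrite /chi raddfD lactDl pureDr. Qed.
Let chi_bal n m a b : chi n (m *r a) b = chi n m (lact a b).
Proof. by rewrite /chi /= /scal_act rmorphM fK lactM pure_bal. Qed.

Let psi (y : h') (n : N') : tens h N := tlift (chi n) y.
Let psi_pure m b n : psi (pure m b) n = pure m (lact (f' b) n).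
Proof. exact: tlift_pure. Qed.
Let psiDl y y' n : psi (y + y') n = psi y n + psi y' n.
Proof. exact: tliftD. Qed.
Let psiDr y n n' : psi y (n + n') = psi y n + psi y n'.
Proof.
elim/tens_ind: y => [y y' IH IH'|m b]; first by rewrite !psiDl IH IH' addrACA.
by rewrite !psi_pure -pureDr -lactDr.
Qed.
Let psi_bal y a n : psi (y *r a) n = psi y (lact a n).
Proof.
elim/tens_ind: y => [y y' IH IH'|m b]; first by rewrite rmulDl !psiDl IH IH'.
rewrite (pureZ (N := hB')) !psi_pure; congr (pure _ _).
by rewrite -[b *r a]/((b : B') * a) rmorphM lactM.
Qed.

Lemma tr_moritaE : exists Phi : tensform h M -> tensform h' M',
  [/\ bijective Phi, forall x y, Phi (x + y) = Phi x + Phi y,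
      forall x d, Phi (x *r d) = Phi x *r Dmap k rho d
    & forall x y, hval (Phi x) (Phi y) = Dmap k rho (hval x y)].
Proof.
have phiE m n : tlift phi (pure m n) = phi m n by exact: tlift_pure.
have psiE y n : tlift psi (pure y n) = psi y n by exact: tlift_pure.
have phiD x y : tlift phi (x + y) = tlift phi x + tlift phi y by exact: tliftD.
have psiD x y : tlift psi (x + y) = tlift psi x + tlift psi y by exact: tliftD.
exists (tlift phi); split=> //.
- exists (tlift psi).
    elim/tens_ind => [x y IH IH'|m n]; first by rewrite phiD psiD IH IH'.
    by rewrite phiE psiE psi_pure rmorph1 lact1.
  elim/tens_ind => [x y IH IH'|y n]; first by rewrite psiD phiD IH IH'.
  rewrite psiE; elim/tens_ind: y => [y y' IH IH'|m b].
    by rewrite psiDl phiD IH IH' -pureDl.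
  rewrite psi_pure phiE /phi -[lact _ _]/(lact (b : B') (n : N')) -pure_bal.
  congr (pure _ _); rewrite (pureZ (N := hB')); congr (pure _ _).
  exact: (@mul1r B').
- move=> x d; elim/tens_ind: x => [x y IH IH'|m n].
    by rewrite rmulDl !phiD IH IH' rmulDl.
  rewrite pureZ !phiE /phi pureZ; congr (pure _ _).
  by rewrite trN_rmul Dmap_can.
- move=> x y; elim/tens_ind: x => [x x' IH IH'|m n].
    rewrite phiD (herm_addl (hvalP (tensform h' M'))) IH IH'.
    by rewrite (herm_addl (hvalP (tensform h M))) rmorphD.
  elim/tens_ind: y => [y y' IH IH'|m' n'].
    rewrite phiD (herm_addr (hvalP (tensform h' M'))) IH IH'.
    by rewrite (herm_addr (hvalP (tensform h M))) rmorphD.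
  rewrite !phiE /phi /= !tval_pure /= /tr_val /tr_act; congr (Dmap k rho (bval _ (lact _ _))).
  by rewrite tval_pure /= /scal_val /scal_act inv_fun1 mul1r mulr1 fK.
Qed.

End TransportCommutes.

Section ExtTransport.
Variables (F K K' : fieldType) (A : falgType F) (sigma : alg_involution A).
Variables (iota : {rmorphism F -> K}) (iota' : {rmorphism F -> K'}).
Variables (rho : {rmorphism K -> K'}) (b : bijective rho).
Variable (Erho : forall c, rho (iota c) = iota' c).

Lemma iso_inv_comp c : iso_inv b (iota' c) = iota c.
Proof. by rewrite -Erho iso_invK'. Qed.

Lemma extmap_inv_bij : bijective (extmap (A := A) iso_inv_comp).
Proof.
exists (extmap (A := A) Erho) => x; apply/rowP => j; rewrite !mxE.
  exact: iso_invK.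
exact: iso_invK'.
Qed.

Lemma extmap_inv_alg c : extmap (A := A) iso_inv_comp c%:A = (iso_inv b c)%:A.
Proof. by rewrite extmapZ rmorph1. Qed.

(* rho(M): the bimodule of M, with the left action of A (x) K' and the right *)
(* action of D' pulled back along the inverse of rho, and with the form      *)
(* rho o b.                                                                  *)
Definition ext_transport (k : kind) (e : bool)
    (M : morita (ext_inv iota sigma) k e) : morita (ext_inv iota' sigma) k e :=
  tr_morita (iso_invK' b) (iso_invK b) extmap_inv_bij extmap_inv_alg
    (extmap_inv iso_inv_comp sigma) M.

Lemma extmapK : cancel (extmap (A := A) Erho) (extmap (A := A) iso_inv_comp).
Proof. by move=> x; apply/rowP => j; rewrite !mxE; exact: iso_invK'. Qed.

(* rho(M) o (id (x) rho)^* = rho^* o M                                       *)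
Lemma ext_transportE (k : kind) (e : bool) (M : morita (ext_inv iota sigma) k e)
    (g : hform (ext_inv iota sigma) false) :
  let Mg := tensform g M in
  let Mg' := tensform (scalext (extmap_inv Erho sigma) g) (ext_transport M) in
  exists Phi : Mg -> Mg',
  [/\ bijective Phi, forall x y, Phi (x + y) = Phi x + Phi y,
      forall x d, Phi (x *r d) = Phi x *r Dmap k rho d
    & forall x y, hval (Phi x) (Phi y) = Dmap k rho (hval x y)].
Proof.
exact: (tr_moritaE (iso_invK' b) (iso_invK b) extmapK extmap_inv_bij
  extmap_inv_alg (extmap_inv Erho sigma) (extmap_inv iso_inv_comp sigma) M g).
Qed.

End ExtTransport.

Definition formally_real (F : fieldType) : Prop :=
  forall u : seq F, \sum_(x <- u) x ^+ 2 != -1.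

(* A point of X_F, given by its positive cone { x | 0 <=_P x }.              *)
Record ordering (F : fieldType) := Ordering {
  pos_cone :> F -> Prop;
  ordD : forall x y, pos_cone x -> pos_cone y -> pos_cone (x + y);
  ordM : forall x y, pos_cone x -> pos_cone y -> pos_cone (x * y);
  ord_total : forall x, pos_cone x \/ pos_cone (- x);
  ord_anti : forall x, pos_cone x -> pos_cone (- x) -> x = 0 }.

Definition real_closure (F : fieldType) (P : ordering F) (K : rcfType)
    (iota : {rmorphism F -> K}) : Prop :=
  (forall x, P x -> exists y, iota x = y ^+ 2) /\
  (forall y, algebraicOver iota y).

Section AlgebrasWithInvolution.
Variables (F : fieldType) (A : falgType F) (sigma : alg_involution A).

(* Two-sided ideals of a unital F-algebra are F-subspaces.                   *)
Definition simple_algebra : Prop :=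
  forall I : {vspace A},
    (forall a x, x \in I -> a * x \in I /\ x * a \in I) ->
    I = 0%VS \/ I = fullv.

Definition first_kind : Prop := simple_algebra /\ 'Z({: A})%VS = 1%VS.

Definition second_kind (d : F) : Prop :=
  [/\ simple_algebra,
      ~ (exists c, d = c ^+ 2),
      (exists2 z : A, z * z = d%:A & 'Z({: A})%VS = (1 + <[z]>)%VS)
    & exists2 c, c \in 'Z({: A})%VS & sigma c != c].

Definition algebra_with_involution : Prop :=
  first_kind \/ exists d, second_kind d.

Local Notation dim_sym := (\dim (fixedSpace (linfun (sigma : A -> A)))).

Definition orthogonal : Prop :=
  first_kind /\
  exists m, \dim {: A} = (m ^ 2)%N /\ dim_sym = ((m * m.+1) %/ 2)%N.

Definition symplectic : Prop :=
  first_kind /\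
  exists m, \dim {: A} = (m ^ 2)%N /\ dim_sym = ((m * m.-1) %/ 2)%N.

(* epsilon_P is -1 (encoded by true) iff one of sigma, theta_P is orthogonal *)
(* and the other symplectic.                                                 *)
Definition eps_at (k : kind) : bool :=
  `[< (orthogonal /\ k = DQuat) \/ (symplectic /\ k = DSplit) >].

End AlgebrasWithInvolution.

Definition matrix_algebra_over (K : fieldType) (B : lalgType K) (k : kind) :
    Prop :=
  exists m (f : {rmorphism B -> 'M[Dring k K]_m.+1}),
    bijective f /\ forall c : K, f c%:A = (Dconst k c)%:M.

Definition kind_at (F : fieldType) (A : falgType F) (sigma : alg_involution A)
    (P : ordering F) (K : fieldType) (iota : {rmorphism F -> K}) (k : kind) :
    Prop :=
  match k with
  | DSplit | DQuat => first_kind A /\ matrix_algebra_over (ext A iota) k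
  | DComplex => exists d, second_kind sigma d /\ P (- d)
  | DExch => exists d, second_kind sigma d /\ P d
  end.

(* L = F[X]/(R) with theta the class of X, R = R_1 ... R_t in K[X], and the  *)
(* resulting isomorphism omega : L (x)_F K -> F_1 x ... x F_t of K-algebras, *)
(* given by its components omega_i, where F_i = K[X]/(R_i).                  *)
Record splitting (F K : fieldType) (L : fieldExtType F)
    (iota : {rmorphism F -> K}) := Splitting {
  sp_theta : L;
  sp_gen : <<1; sp_theta>>%VS = fullv;
  sp_R : {poly F};
  sp_irr : irreducible_poly sp_R;
  sp_root : root (map_poly (in_alg L) sp_R) sp_theta;
  sp_t : nat;
  sp_r : nat;
  sp_rt : (sp_r <= sp_t)%N;
  sp_fac : 'I_sp_t -> {poly K};
  sp_mi : forall i, monic_irreducible_poly (sp_fac i);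
  sp_inj : injective sp_fac;
  sp_prod : map_poly iota sp_R = \prod_i sp_fac i;
  sp_size : forall i : 'I_sp_t, size (sp_fac i) = if (i < sp_r)%N then 2 else 3;
  sp_omega : forall i, {rmorphism ext L iota -> {poly %/ sp_fac i with sp_mi i}};
  sp_omega0 : forall i (c : K), sp_omega i c%:A = qfpoly_const (sp_mi i) c;
  sp_omega1 : forall i, sp_omega i (extin iota sp_theta) = in_qpoly (sp_fac i) 'X;
  sp_bij : forall y : (forall i, {poly %/ sp_fac i with sp_mi i}),
    exists! x, forall i, sp_omega i x = y i }.

Section SplittingTheory.
Variables (F K : fieldType) (L : fieldExtType F) (iota : {rmorphism F -> K}).
Variable S : splitting L iota.

Definition sp_lin (i : 'I_(sp_r S)) : 'I_(sp_t S) := widen_ord (sp_rt S) i.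

Definition sp_field (i : 'I_(sp_t S)) : fieldType :=
  {poly %/ sp_fac i with sp_mi i}.

Definition omega (i : 'I_(sp_t S)) : {rmorphism ext L iota -> sp_field i} :=
  sp_omega i.

Definition omega_iota0 (i : 'I_(sp_t S)) : {rmorphism K -> sp_field i} :=
  omega i \o in_alg (ext L iota).

Definition omega_iota1 (i : 'I_(sp_t S)) : {rmorphism L -> sp_field i} :=
  omega i \o (extin iota : {rmorphism L -> ext L iota}).

Lemma omega_compat i c :
  omega_iota0 i (iota c) = (omega_iota1 i \o in_alg L) c.
Proof. by rewrite /= -[in RHS](rmorph1 (in_alg L)) /= extinZ ?rmorph1 scale1r. Qed.

Lemma omega_iota0_bij (i : 'I_(sp_r S)) : bijective (omega_iota0 (sp_lin i)).
Proof.
set j := sp_lin i.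
have sz : size (sp_fac j) = 2%N by have:= ltn_ord i; rewrite sp_size /= => ->.
have const (y : sp_field j) : omega_iota0 j (val y : {poly K})`_0 = y.
  rewrite /omega_iota0 /= /omega sp_omega0; apply: val_inj; rewrite /= .
  apply/esym/size1_polyC; have := size_npoly y.
  by move/leq_trans; apply; rewrite (mk_monicE (sp_mi j)) sz.
exists (fun y : sp_field j => (val y : {poly K})`_0) => [c|//].
by apply: (fmorph_inj (omega_iota0 j)); rewrite const.
Qed.

End SplittingTheory.

Section Signatures.
Variables (F : fieldType) (A : falgType F) (sigma : alg_involution A).

Lemma extin_inv (K : fieldType) (iota : {rmorphism F -> K}) a :
  extin iota (sigma a) = ext_inv iota sigma (extin iota a).
Proof. by rewrite /= ext_inv_extin. Qed.

(* sign_iota^M h for h over (A, sigma) *)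
Definition sign_base (K : fieldType) (iota : {rmorphism F -> K}) (k : kind)
    (e : bool) (M : morita (ext_inv iota sigma) k e) (h : hform sigma false) :
    int :=
  msign (f := extin iota : {rmorphism A -> ext A iota}) (extin_inv iota) M h.

(* sign_kappa^M h for h over (A (x)_F L, sigma (x) id), with                 *)
(* (A (x)_F L) (x)_L K = A (x)_F K, where K is an F-algebra through kappa    *)
Definition sign_ext (L : fieldExtType F) (K : fieldType)
    (kappa : {rmorphism L -> K}) (k : kind) (e : bool)
    (M : morita (ext_inv (kappa \o in_alg L) sigma) k e)
    (h : hform (ext_inv (in_alg L) sigma) false) : int :=
  msign (extmap_inv (iota := in_alg L) 
    (iota' := kappa \o in_alg L) (rho := kappa) (fun=> erefl) sigma) M h.

End Signatures.

(* Main.v *)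
(* Over D, the transferred form V = M(Tr h (x) K) is the tensor product of h *)
(* and the Morita bimodule over A, and L (x)_F K acts on it by self-adjoint  *)
(* D-linear maps. The idempotents of L (x)_F K belonging to the linear       *)
(* factors R_i split V into orthogonal pieces and a rest. As such an         *)
(* idempotent has trace 1, its piece is isometric to the i-th summand on the *)
(* right-hand side. On the rest, a square root of -1 in the product of the   *)
(* algebraically closed factors is an anti-isometry, so the rest has         *)
(* signature 0 by the law of inertia. When M takes values in skew-hermitian  *)
(* forms or in forms over K x K, both sides are 0 by definition.             *)

Require Import Defs.
From HB Require Import structures.
From mathcomp Require Import all_boot all_order all_algebra all_field.
From mathcomp Require Import boolp classical_sets.
From mathcomp Require Import complex.
From mathcomp Require Import ring.

Set Implicit Arguments.
Unset Strict Implicit.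
Unset Printing Implicit Defensive.

Import GRing.Theory VectorInternalTheory.
Local Open Scope ring_scope.

(** * Orthonormal families and the law of inertia over a division ring *)

(** Let V = [morita_transfer M h], whose signature is the left-hand side. Collapsing tensor
    products, V is the tensor product of [h] and the Morita bimodule over A. So L acts on the first
    factor, K on the second, and L (x)_F K acts on V by self-adjoint D-linear maps
    ([field_act_adj]). Each linear factor of R gives an idempotent e_i, and 1 is the sum of the e_i
    and of [coidem]; hence V is the orthogonal sum of the e_i V and a remainder.

    Multiplication by e_i has rank one, so the K-linear extension of Tr_{L/F} takes e_i z to the
    i-th coordinate of z. Cutting the form down by e_i therefore undoes the transfer and leaves [h]
    evaluated at the i-th ordering: [branch_embedding] identifies e_i V with the i-th summand on the
    right, along the isomorphism of K with F_i. On the remainder, square roots of -1 in the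
    quadratic factors give an operator J with J^2 = -1 and h(Jx, Jy) = -h(x, y), so its signature is
    its own negative ([diag_sign_morita_transfer]).

    Signatures are well defined and additive by the law of inertia ([sylvester]) and the existence
    of orthonormal bases in images of self-adjoint idempotents ([orthonormal_basis]). Both rest on
    the properties of D collected in [positive_inv]. Nonsingularity and projectivity enter through
    [dual_basis], which survives tensor products and, as the trace form is nondegenerate,
    transfer. *)

Record positive_inv (D : nzRingType) (t : involution D) : Prop := PositiveInv {
  posinv_unit : forall d : D, d != 0 -> exists d', d * d' = 1 /\ d' * d = 1;
  posinv_herm : forall d, t d = d -> d != 0 ->
    exists x (b : bool), t x * d * x = (-1) ^+ b;
  posinv_aniso : forall (I : finType) (x : I -> D),
    \sum_i t (x i) * x i = 0 -> forall i, x i = 0 }.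

Section DivisionRing.
Variable D : nzRingType.
Hypothesis D_unit : forall d : D, d != 0 -> exists d', d * d' = 1 /\ d' * d = 1.

(** Gaussian elimination: a nonzero entry of the first equation removes its unknown from the others.
    Coefficients stand on the left and unknowns on the right, as suits right modules over a
    noncommutative [D]. *)
Lemma homogeneous_system_ord n m (C : 'I_n -> 'I_m -> D) : (n < m)%N ->
  exists2 x : 'I_m -> D, (exists j, x j != 0)
    & forall i, \sum_j C i j * x j = 0.
Proof.
elim: n m C => [|n IHn] [//|m] C ltnm.
  exists (fun=> 1); first by exists ord0; exact: oner_neq0.
  by case.
have [j0 Cj0|C0] := pickP (fun j => C ord0 j != 0); last first.
  have [x xn0 Cx] := IHn m.+1 (fun i => C (lift ord0 i)) (ltnW ltnm).
  exists x => // i; case: (unliftP ord0 i) => [i' ->|->]; first exact: Cx.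
  by rewrite big1 // => j _; move/negbFE/eqP: (C0 j) => ->; rewrite mul0r.
have [c [Cc _]] := D_unit Cj0.
have [y [j yj] Cy] := IHn m (fun i j => C (lift ord0 i) (lift j0 j)
  - C (lift ord0 i) j0 * c * C ord0 (lift j0 j)) ltnm.
pose z := \sum_j C ord0 (lift j0 j) * y j.
pose x j := oapp y (- (c * z)) (unlift j0 j).
have xl l : x (lift j0 l) = y l by rewrite /x liftK.
have x0 : x j0 = - (c * z) by rewrite /x unlift_none.
exists x; first by exists (lift j0 j); rewrite xl.
move=> i; rewrite (bigD1_ord j0) //= x0; under eq_bigr do rewrite xl.
case: (unliftP ord0 i) => [i' ->|->]; last by rewrite mulrN mulrA Cc mul1r addNr.
rewrite -[RHS](Cy i') mulrN addrC.
under [in RHS]eq_bigr do rewrite mulrBl -!mulrA.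
by rewrite sumrB -!mulr_sumr.
Qed.

Lemma homogeneous_system (I J : finType) (C : J -> I -> D) : (#|J| < #|I|)%N ->
  exists2 x : I -> D, (exists i, x i != 0) & forall j, \sum_i C j i * x i = 0.
Proof.
move=> ltJI.
have [x [i xi] Cx] :=
  homogeneous_system_ord (fun j i => C (enum_val j) (enum_val i)) ltJI.
exists (fun i => x (enum_rank i)); first by exists (enum_val i); rewrite enum_valK.
move=> j; rewrite -[RHS](Cx (enum_rank j)) (reindex (@enum_val I I)) /=.
  by apply: eq_bigr => l _; rewrite enum_rankK enum_valK.
by apply: onW_bij; exact: enum_val_bij.
Qed.

End DivisionRing.

Section Hermitian.
Variables (D : nzRingType) (t : involution D) (e : bool) (M : lmodType D^c).
Variables (h : M -> M -> D) (hP : is_herm t e h).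

Lemma herm0l y : h 0 y = 0.
Proof. by apply: (addrI (h 0 y)); rewrite -(herm_addl hP) !addr0. Qed.
Lemma herm0r x : h x 0 = 0.
Proof. by apply: (addrI (h x 0)); rewrite -(herm_addr hP) !addr0. Qed.
Lemma herm_Nl x y : h (- x) y = - h x y.
Proof. by apply/eqP; rewrite -addr_eq0 -(herm_addl hP) addNr herm0l. Qed.
Lemma herm_Nr x y : h x (- y) = - h x y.
Proof. by apply/eqP; rewrite -addr_eq0 -(herm_addr hP) addNr herm0r. Qed.
Lemma herm_suml I (r : seq I) (P : pred I) (f : I -> M) y :
  h (\sum_(i <- r | P i) f i) y = \sum_(i <- r | P i) h (f i) y.
Proof. exact: (big_morph (h^~ y) (fun x x' => herm_addl hP x x' y) (herm0l y)). Qed.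
Lemma herm_sumr I (r : seq I) (P : pred I) (f : I -> M) x :
  h x (\sum_(i <- r | P i) f i) = \sum_(i <- r | P i) h x (f i).
Proof. exact: (big_morph (h x) (herm_addr hP x) (herm0r x)). Qed.
Lemma herm_mulr x y a : h x (y *r a) = h x y * a.
Proof. by rewrite -[x in LHS]rmul1 (herm_scale hP) inv_fun1 mul1r. Qed.
Lemma herm_mull x y a : h (x *r a) y = t a * h x y.
Proof. by rewrite -[y in LHS]rmul1 (herm_scale hP) mulr1. Qed.

(** Projectivity and nonsingularity in one: the coordinate functionals of a finite generating family
    are represented by the form. *)
Definition dual_basis : Prop :=
  exists (I : finType) (m m' : I -> M), forall x, x = \sum_i m i *r h (m' i) x.

Lemma nonsingular_dual_basis : fg_projective M -> nonsingular h -> dual_basis.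
Proof.
move=> [n [i [p ipK]]] hns.
have /choice[m' m'E] (j : 'I_n) : exists x, forall y, i y 0 j = h x y :> D.
  pose f (y : M) : (D^c)^o := i y 0 j.
  have lf : linear f by move=> c x y; rewrite /f linearP !mxE.
  have [x [xE _]] :=
    hns (HB.pack_for {linear M -> (D^c)^o} f (GRing.isLinear.Build _ _ _ _ f lf)).
  by exists x.
exists 'I_n, (fun j => p (delta_mx 0 j)), m' => x.
rewrite -[LHS]ipK [i x in LHS]row_sum_delta linear_sum; apply: eq_bigr => j _.
by rewrite linearZ -m'E.
Qed.

End Hermitian.

Section SignFamilies.
Variables (D : nzRingType) (t : involution D) (U : hform t false).
Let hP := hvalP U.

Definition orthonormal (I : finType) (v : I -> U) (a : I -> bool) : Prop :=
  forall i j, hval (v i) (v j) = if i == j then (-1) ^+ a i else 0.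

Definition spans (I : finType) (v : I -> U) (x : U) : Prop :=
  exists c : I -> D, x = \sum_i v i *r c i.

Lemma orthonormal_coord (I : finType) (v : I -> U) a (c : I -> D) i :
  orthonormal v a -> hval (v i) (\sum_j v j *r c j) = (-1) ^+ a i * c i.
Proof.
move=> va; rewrite (herm_sumr hP) (bigD1 i) //= (herm_mulr hP) va eqxx.
rewrite big1 ?addr0 // => j ji.
by rewrite (herm_mulr hP) va eq_sym (negPf ji) mul0r.
Qed.

Lemma orthonormal_inj (I : finType) (v : I -> U) a (c : I -> D) :
  orthonormal v a -> \sum_j v j *r c j = 0 -> forall i, c i = 0.
Proof.
move=> va vc0 i; have := orthonormal_coord c i va.
by rewrite vc0 (herm0r hP) => /esym/(canRL (signrMK _)); rewrite mulr0.
Qed.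

Lemma orthonormal_norm (I : finType) (v : I -> U) a (c : I -> D) :
  orthonormal v a -> hval (\sum_j v j *r c j) (\sum_j v j *r c j) =
    \sum_i (-1) ^+ a i * (t (c i) * c i).
Proof.
move=> va; rewrite (herm_suml hP); apply: eq_bigr => i _.
rewrite (herm_mull hP) (orthonormal_coord _ _ va).
by rewrite mulrA (commr_sign _ (a i)) mulrA.
Qed.

Lemma orthonormal_diagonalizes (I : finType) (v : I -> U) a :
  orthonormal v a -> (forall x, spans v x) ->
  diagonalizes U (fun i : 'I_#|I| => a (enum_val i)).
Proof.
move=> va vs; exists (fun i => v (enum_val i)); split=> [x|i j]; last first.
  by rewrite va (inj_eq enum_val_inj).
have [c ->] := vs x.
have reE (d : I -> D) : \sum_i v i *r d i =
    \sum_(i < #|I|) v (enum_val i) *r d (enum_val i).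
  rewrite (reindex (@enum_val I I)) //=.
  by apply: onW_bij; exact: enum_val_bij.
exists [ffun i => c (enum_val i)]; split=> [|d /esym dE].
  by rewrite reE; apply: eq_bigr => i _; rewrite ffunE.
apply/ffunP => i; rewrite ffunE.
pose d' j := d (enum_rank j).
have {}dE : \sum_j v j *r d' j = \sum_j v j *r c j.
  by rewrite -dE reE; apply: eq_bigr => j _; rewrite /d' enum_valK.
have := orthonormal_coord d' (enum_val i) va.
rewrite dE (orthonormal_coord _ _ va) => /(can_inj (signrMK _)) ->.
by rewrite /d' enum_valK.
Qed.

Lemma diagonalizes_orthonormal n (a : 'I_n -> bool) : diagonalizes U a ->
  exists2 v, orthonormal v a & forall x, spans v x.
Proof.
move=> [v [vc va]]; exists v => // x; have [c [cE _]] := vc x.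
by exists c.
Qed.

End SignFamilies.

Section Sylvester.
Variables (D : nzRingType) (t : involution D) (U : hform t false).
Hypothesis tpos : positive_inv t.
Let hP := hvalP U.

(** If sign [s] were more frequent in [v], some nonzero combination u of the vectors of sign [s] in
    [v] would be orthogonal to those in [w]. Then h(u, u) is (-1)^s times a sum of terms t(x) x
    along [v], and minus (-1)^s times such a sum along [w], so the two sums add up to 0, against
    [posinv_aniso]. *)
Lemma sylvester_le (I J : finType) (v : I -> U) a (w : J -> U) b (s : bool) :
  orthonormal v a -> orthonormal w b -> (forall x, spans w x) ->
  (#|[pred i | a i == s]| <= #|[pred j | b j == s]|)%N.
Proof.
move=> va wb ws; rewrite leqNgt; apply/negP.
rewrite -(card_sig [pred i | a i == s]) -(card_sig [pred j | b j == s]).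
set I' := [the finType of {i | a i == s}]; set J' := [the finType of {j | b j == s}] => ltJI.
have [x [i0 xi0] xE] := homogeneous_system (posinv_unit tpos)
  (fun (j : J') (i : I') => hval (w (val j)) (v (val i))) ltJI.
have v'a : orthonormal (fun i : I' => v (val i)) (fun=> s).
  by move=> i j; rewrite va (inj_eq val_inj) (eqP (valP i)).
set u := \sum_(i : I') v (val i) *r x i.
have [c cE] := ws u.
have c0 j : b j == s -> c j = 0.
  move=> bj; apply: (can_inj (signrMK (b j))).
  rewrite mulr0 -(orthonormal_coord _ _ wb) -cE -[RHS](xE (exist _ j bj)).
  by rewrite (herm_sumr hP); apply: eq_bigr => i _; rewrite (herm_mulr hP).
have := orthonormal_norm x v'a; rewrite -/u cE (orthonormal_norm _ wb).
have -> : \sum_j (-1) ^+ b j * (t (c j) * c j) =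
    - (-1) ^+ s * \sum_j t (c j) * c j.
  rewrite mulr_sumr; apply: eq_bigr => j _.
  have [/c0 ->|] := boolP (b j == s); first by rewrite !mulr0.
  by case: (b j) (s) => -[] //= _; rewrite ?opprK.
rewrite -mulr_sumr mulNr => /esym/eqP; rewrite -addr_eq0 -mulrDr.
rewrite -(inj_eq (can_inj (signrMK s))) signrMK mulr0.
(* Both coordinate families are merged into one, to which anisotropy applies. *)
pose y (i : I' + J) := match i with inl i => x i | inr j => c j end.
have <- : \sum_i t (y i) * y i = \sum_i t (x i) * x i + \sum_j t (c j) * c j.
  by rewrite big_sumType.
move=> /eqP/(posinv_aniso tpos)/(_ (inl i0)) /= /eqP.
by rewrite (negPf xi0).
Qed.

Lemma sylvester (I J : finType) (v : I -> U) a (w : J -> U) b :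
  orthonormal v a -> orthonormal w b ->
  (forall x, spans v x) -> (forall x, spans w x) ->
  \sum_i (-1) ^+ a i = \sum_j (-1) ^+ b j :> int.
Proof.
move=> va wb vs ws.
have card s : #|[pred i | a i == s]| = #|[pred j | b j == s]|.
  by apply/eqP; rewrite eqn_leq (sylvester_le s va wb) // (sylvester_le s wb va).
have sumE (I' : finType) (a' : I' -> bool) : \sum_i (-1) ^+ a' i =
    #|[pred i | a' i == false]|%:Z - #|[pred i | a' i == true]|%:Z.
  rewrite (bigID (fun i => a' i == false)) /=; congr (_ + _).
    rewrite (eq_bigr (fun=> 1)) => [|i /eqP -> //].
    by rewrite sumr_const natz.
  rewrite (eq_bigr (fun=> -1)) => [|i]; last by case: (a' i).
  rewrite sumr_const mulNrn natz; congr (- _%:Z).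
  by apply: eq_card => i; rewrite !inE unfold_in /=; case: (a' i).
by rewrite !sumE !card.
Qed.

End Sylvester.

Section OrthonormalBases.
Variables (D : nzRingType) (t : involution D) (U : hform t false).
Hypothesis tpos : positive_inv t.
Let hP := hvalP U.

(** Otherwise a nonzero combination of [v] is killed by every functional of the dual basis, hence is
    0. This bound makes a longest orthonormal family exist. *)
Lemma orthonormal_card (I : finType) (v : I -> U) a (J : finType) (m m' : J -> U) :
  orthonormal v a -> (forall x, x = \sum_j m j *r hval (m' j) x) ->
  (#|I| <= #|J|)%N.
Proof.
move=> va mm'; rewrite leqNgt; apply/negP => ltJI.
have [x [i xi] xE] := homogeneous_system (posinv_unit tpos)
  (fun j i => hval (m' j) (v i)) ltJI.
have vx0 : \sum_i v i *r x i = 0.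
  rewrite [LHS]mm' big1 // => j _.
  rewrite (herm_sumr hP); under eq_bigr do rewrite (herm_mulr hP).
  by rewrite xE /rmul scale0r.
by have := orthonormal_inj va vx0 i => /eqP; rewrite (negPf xi).
Qed.

(* Expand the form at x + y *r t d, where d = hval x y. *)
Lemma herm_isotropic (Q : U -> Prop) :
  (forall x y, Q x -> Q y -> Q (x + y)) -> (forall x d, Q x -> Q (x *r d)) ->
  (forall x, Q x -> hval x x = 0) -> forall x y, Q x -> Q y -> hval x y = 0.
Proof.
move=> QD Qr Q0 x y Qx Qy; set d := hval x y.
have := Q0 _ (QD _ _ Qx (Qr _ (t d) Qy)).
rewrite (herm_addl hP) !(herm_addr hP) !(herm_mulr hP) !(herm_mull hP).
rewrite !Q0 // !(mul0r, mulr0, add0r, addr0).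
rewrite (herm_sym hP x y) -/d expr0 mul1r inv_funK.
(* The expansion is d (t d) taken twice; reading it as a sum over [bool] gives t d = 0 without
   dividing by 2. *)
pose z (b : bool) := t d.
move=> H; have := posinv_aniso tpos (x := z) _ true.
rewrite big_bool /z /= inv_funK => /(_ H) td0.
by rewrite -[d](inv_funK t) td0 raddf0.
Qed.

Variable E : U -> U.
Hypotheses (ED : forall x y, E (x + y) = E x + E y).
Hypotheses (Er : forall x d, E (x *r d) = E x *r d).
Hypotheses (EE : forall x, E (E x) = E x).
Hypotheses (Eadj : forall x y, hval (E x) y = hval x (E y)).

(** A longest orthonormal family in the image of [E] spans it. A vector of nonzero norm in its
    orthogonal complement [Q] within the image could be rescaled to norm 1 or -1 and added; so norms
    vanish on [Q], and with them the form, by [herm_isotropic]. As [E] is self-adjoint, [Q] is then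
    orthogonal to all of [U], hence 0 by the dual basis. *)
Lemma orthonormal_basis : dual_basis (hval (h := U)) ->
  exists (I : finType) (v : I -> U) a, [/\ orthonormal v a, forall i, E (v i) = v i
    & forall x, E x = x -> spans v x].
Proof.
move=> [J [m [m' mm']]].
pose P n := exists (I : finType) (v : I -> U) a,
  [/\ #|I| = n, orthonormal v a & forall i, E (v i) = v i].
have P0 : exists n, `[< P n >].
  exists 0; apply/asboolP; exists 'I_0, (fun=> 0), (fun=> false).
  by split; [rewrite card_ord|case|case].
have Pmax n : `[< P n >] -> (n <= #|J|)%N.
  move/asboolP => [I [v [a [<- va _]]]]; exact: orthonormal_card va mm'.
case: (ex_maxnP P0 Pmax) => _ /asboolP[I [v [a [<- va vE]]]] Imax {P0 Pmax}.
exists I, v, a; split => // x Ex.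
pose c i := (-1) ^+ a i * hval (v i) x.
exists c; apply/eqP; rewrite -subr_eq0; apply/eqP.
pose Q y := E y = y /\ forall i, hval (v i) y = 0.
have QD y z : Q y -> Q z -> Q (y + z).
  move=> [Ey vy] [Ez vz]; split; first by rewrite ED Ey Ez.
  by move=> i; rewrite (herm_addr hP) vy vz addr0.
have Qr y d : Q y -> Q (y *r d).
  move=> [Ey vy]; split; first by rewrite Er Ey.
  by move=> i; rewrite (herm_mulr hP) vy mul0r.
have Q0 y : Q y -> hval y y = 0.
  move=> [Ey vy]; apply/eqP/negP => /negP yy0.
  have tyy : t (hval y y) = hval y y by rewrite [RHS](herm_sym hP) expr0 mul1r.
  have [s [b sE]] := posinv_herm tpos tyy yy0.
  pose v' (i : option I) := oapp v (y *r s) i.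
  pose a' i := oapp a b i.
  have vy' i : hval (v i) (y *r s) = 0 by rewrite (herm_mulr hP) vy mul0r.
  suff /Imax : `[< P #|I|.+1 >] by rewrite ltnn.
  apply/asboolP; exists (option I), v', a'; split; first by rewrite card_option.
    move=> [i|] [j|]; rewrite /v' /a' /=.
    - by rewrite va.
    - by rewrite vy'.
    - by rewrite (herm_sym hP) vy' raddf0 mulr0.
    - by rewrite (herm_scale hP) sE.
  by case=> [i|] /=; rewrite ?Er ?Ey.
have EN z : E (- z) = - E z by have := Er z (-1); rewrite /rmul !scaleN1r.
have E0 : E 0 = 0 by have := Er 0 0; rewrite /rmul !scaler0 scale0r.
have Qproj z : E z = z -> Q (z - \sum_i v i *r ((-1) ^+ a i * hval (v i) z)).
  move=> Ez; split=> [|i].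
    rewrite ED Ez EN (big_morph E ED E0); congr (_ - _).
    by apply: eq_bigr => i _; rewrite Er vE.
  by rewrite (herm_addr hP) (herm_Nr hP) (orthonormal_coord _ _ va) signrMK subrr.
have Qy := Qproj x Ex; set y := x - _ in Qy *.
have Qiso := herm_isotropic QD Qr Q0.
have y0 z : hval z y = 0.
  suff {z} H z : E z = z -> hval z y = 0.
    have [Ey _] := Qy; rewrite -Ey -Eadj; apply: H; exact: EE.
  move=> Ez; have Qw := Qproj z Ez.
  have := Qiso _ _ Qw Qy; rewrite (herm_addl hP) (herm_Nl hP) (herm_suml hP).
  rewrite big1 ?subr0 // => i _.
  by rewrite (herm_mull hP) (proj2 Qy) mulr0.
by rewrite [LHS]mm' big1 // => j _; rewrite y0 /rmul scale0r.
Qed.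

End OrthonormalBases.

(** [diag_sign] chooses some diagonalization; by inertia any other yields the same number. *)
Lemma diag_signE (D : nzRingType) (t : involution D) (U : hform t false)
    (I : finType) (v : I -> U) a :
  positive_inv t -> orthonormal v a -> (forall x, spans v x) ->
  diag_sign U = \sum_i (-1) ^+ a i.
Proof.
move=> tpos va vs; rewrite /diag_sign; set Z := [set z | _]%classic.
have [n [b [/diagonalizes_orthonormal[w wb ws] ->]]] : Z (xget 0 Z).
  apply: (@xgetI _ 0 Z (\sum_(i < #|I|) (-1) ^+ a (enum_val i))).
  exists #|I|, (fun i => a (enum_val i)); split=> //.
  exact: orthonormal_diagonalizes.
exact: (sylvester tpos wb va).
Qed.

Lemma diag_sign_orthonormal (D : nzRingType) (t : involution D) (U : hform t false) :
  positive_inv t -> dual_basis (hval (h := U)) ->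
  exists (I : finType) (v : I -> U) a, [/\ orthonormal v a, forall x, spans v x
    & diag_sign U = \sum_i (-1) ^+ a i].
Proof.
move=> tpos db.
have [I [v [a [va _ vs]]]] := orthonormal_basis tpos (E := id)
  (fun _ _ => erefl) (fun _ _ => erefl) (fun=> erefl) (fun _ _ => erefl) db.
exists I, v, a; split=> // [x|]; first exact: vs.
by apply: diag_signE => // x; exact: vs.
Qed.

(** Carries positivity from [K] to the fields F_i of the linear factors, which are available only as
    fields isomorphic to [K]. *)
Lemma positive_inv_iso (D D' : nzRingType) (t : involution D) (t' : involution D')
    (g : {rmorphism D -> D'}) (g' : {rmorphism D' -> D}) :
  cancel g g' -> cancel g' g -> (forall d, g (t d) = t' (g d)) ->
  positive_inv t -> positive_inv t'.
Proof.
move=> gK g'K gt [tu th ta].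
have g't d : g' (t' d) = t (g' d) by rewrite -{1}[d]g'K -gt gK.
have g'0 d : d != 0 -> g' d != 0 by rewrite -(inj_eq (can_inj g'K)) raddf0.
split=> [d /g'0/tu[c [dc cd]]|d td /g'0|I x x0 i].
- by exists (g c); rewrite -{1}[d]g'K -{2}[d]g'K -!rmorphM dc cd rmorph1.
- have := th (g' d); rewrite -g't td => th' /(th' erefl)[x [b xE]].
  exists (g x), b; rewrite -gt -[d]g'K -!rmorphM.
  by rewrite xE rmorph_sign.
- apply: (can_inj g'K); rewrite raddf0.
  apply: (ta I (fun i => g' (x i))).
  have := congr1 g' x0; rewrite raddf0 rmorph_sum; apply: etrans.
  by apply: eq_bigr => j _; rewrite rmorphM g't.
Qed.

(** * Positivity of the standard involutions over a real closed field *)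

Section PositiveDinv.
Variable K : rcfType.
Import Order.TTheory Num.Theory.

(** The product t(d) d, read in [K]. The value for [DExch] is a dummy. *)
Definition Dnorm (k : kind) : Dring k K -> K :=
  match k return Dring k K -> K with
  | DSplit => fun c => c ^+ 2
  | DQuat => fun d => qre d ^+ 2 + qi d ^+ 2 + qj d ^+ 2 + qk d ^+ 2
  | DComplex => fun d => complex.Re d ^+ 2 + complex.Im d ^+ 2
  | DExch => fun=> 0
  end.

Lemma Dconst_zmod (k : kind) : zmod_morphism (@Dconst k K).
Proof. by case: k => //= x y; [congr Quat|congr complex.Complex]; rewrite /= ?subrr. Qed.

Lemma Dconst_monoid (k : kind) : monoid_morphism (@Dconst k K).
Proof.
case: k => //; split=> // x y; [congr Quat|congr complex.Complex]; rewrite /=; ring.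
Qed.

HB.instance Definition _ (k : kind) :=
  GRing.isZmodMorphism.Build K (Dring k K) (@Dconst k K) (@Dconst_zmod k).
HB.instance Definition _ (k : kind) :=
  GRing.isMonoidMorphism.Build K (Dring k K) (@Dconst k K) (@Dconst_monoid k).

Lemma Dconst_comm (k : kind) c (d : Dring k K) : Dconst k c * d = d * Dconst k c.
Proof.
case: k d => /= [d|[a1 a2 a3 a4]|[a1 a2]|[a b]];
  [|congr Quat|congr complex.Complex|congr pair] => /=; ring.
Qed.

Lemma Dinv_const (k : kind) c : Dinv k K (Dconst k c) = Dconst k c.
Proof. by case: k; rewrite /= /quat_conj /= ?oppr0. Qed.

Lemma Dconst_inj (k : kind) : injective (@Dconst k K).
Proof. by case: k => x y //= []. Qed.

Variable k : kind.
Hypothesis kE : k <> DExch.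

Lemma Dnorm_ge0 (d : Dring k K) : 0 <= Dnorm d.
Proof. by move: d; case: (k) => //= d; rewrite ?addr_ge0 ?sqr_ge0. Qed.

Lemma Dnorm_eq0 (d : Dring k K) : Dnorm d = 0 -> d = 0.
Proof.
move: kE d; case: (k) => //= _ d /eqP.
- by rewrite sqrf_eq0 => /eqP.
- rewrite !paddr_eq0 ?addr_ge0 ?sqr_ge0 // !sqrf_eq0.
  by case: d => /= a1 a2 a3 a4 /andP[/andP[/andP[/eqP-> /eqP->] /eqP->] /eqP->].
- rewrite !paddr_eq0 ?addr_ge0 ?sqr_ge0 // !sqrf_eq0.
  by case: d => /= a1 a2 /andP[/eqP-> /eqP->].
Qed.

Lemma DnormE (d : Dring k K) : Dinv k K d * d = Dconst k (Dnorm d).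
Proof.
move: kE d; case: (k) => //= _ => [[a1 a2 a3 a4]|[a1 a2]].
  by congr Quat => /=; ring.
by congr complex.Complex => /=; ring.
Qed.

Lemma Dinv_fixed (d : Dring k K) : Dinv k K d = d -> exists c, d = Dconst k c.
Proof.
have H (x : K) : - x = x -> x = 0.
  by move/eqP; rewrite eq_sym -addr_eq0 -mulr2n mulrn_eq0 => /eqP.
move: kE d; case: (k) => //= _ => [d _|[a1 a2 a3 a4] [/H-> /H-> /H->]|[a1 a2] [/H->]].
- by exists d.
- by exists a1.
- by exists a1.
Qed.

(** [Dnorm] is a sum of squares that vanishes only at 0, which gives inverses by conjugation and
    anisotropy. Symmetric elements lie in [K], where each is a sign times a square. *)
Lemma positive_inv_Dinv : positive_inv (Dinv k K).
Proof.
split=> [d d0|d /Dinv_fixed[c ->] c0|I x].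
- have n0 : Dnorm d != 0 by apply: contra_neq d0 => /Dnorm_eq0.
  have nd : d * Dinv k K d = Dconst k (Dnorm d).
    have := DnormE (Dinv k K d); rewrite inv_funK => ->; congr (Dconst k _).
    by move: kE d {d0 n0}; case: (k) => //= _ => [[? ? ? ?]|[? ?]]; rewrite /= ?sqrrN.
  exists (Dinv k K d * Dconst k (Dnorm d)^-1).
  split; first by rewrite mulrA nd -rmorphM mulfV // rmorph1.
  by rewrite -Dconst_comm -mulrA DnormE -rmorphM mulVf // rmorph1.
- have {}c0 : c != 0 by apply: contra_neq c0 => ->; rewrite raddf0.
  have n0 : 0 < `|c| by rewrite normr_gt0.
  exists (Dconst k (Num.sqrt `|c|)^-1), (c < 0).
  rewrite Dinv_const -!rmorphM mulrAC -expr2 exprVn sqr_sqrtr ?normr_ge0 //.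
  rewrite -(rmorph_sign (@Dconst k K)); congr (Dconst k _).
  by rewrite {2}[c]numEsign mulrC -mulrA mulfV ?mulr1 // gt_eqF.
under eq_bigr do rewrite DnormE.
rewrite -rmorph_sum => H i.
have /eqP : \sum_i Dnorm (x i) = 0.
  by apply: (@Dconst_inj k); rewrite H raddf0.
rewrite psumr_eq0 => [/allP x0|j _]; last exact: Dnorm_ge0.
by apply: (Dnorm_eq0); apply/eqP/x0; rewrite mem_index_enum.
Qed.

End PositiveDinv.

(** * Tensor products and dual bases *)

Section Additive.
Variables (U V : zmodType) (f : U -> V) (fD : forall x y, f (x + y) = f x + f y).

Lemma additive0 : f 0 = 0.
Proof. by apply: (addrI (f 0)); rewrite -fD !addr0. Qed.

Lemma additive_sum I (r : seq I) (P : pred I) (F : I -> U) :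
  f (\sum_(i <- r | P i) F i) = \sum_(i <- r | P i) f (F i).
Proof. exact: (big_morph f fD additive0). Qed.
End Additive.

Section BalancedSums.
Variables (B D : nzRingType) (M : lmodType B^c) (N : bimod B D).

Lemma pure_suml I (r : seq I) (P : pred I) (F : I -> M) (n : N) :
  pure (\sum_(i <- r | P i) F i) n = \sum_(i <- r | P i) pure (F i) n.
Proof. by apply: (additive_sum (f := fun m => pure m n)) => m m'; exact: pureDl. Qed.

Lemma pure_sumr I (r : seq I) (P : pred I) (F : I -> N) (m : M) :
  pure m (\sum_(i <- r | P i) F i) = \sum_(i <- r | P i) pure m (F i).
Proof. by apply: (additive_sum (f := pure m)) => n n'; exact: pureDr. Qed.

Lemma lact_suml I (r : seq I) (P : pred I) (F : I -> B) (n : N) :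
  lact (\sum_(i <- r | P i) F i) n = \sum_(i <- r | P i) lact (F i) n.
Proof. by apply: (additive_sum (f := fun a => lact a n)) => a b; exact: lactDl. Qed.

Lemma rmul_sumr I (r : seq I) (P : pred I) (F : I -> B) (m : M) :
  m *r (\sum_(i <- r | P i) F i) = \sum_(i <- r | P i) m *r F i.
Proof. by apply: (additive_sum (f := rmul m)) => a b; exact: rmulDr. Qed.

Lemma rmul_suml I (r : seq I) (P : pred I) (F : I -> M) (b : B) :
  (\sum_(i <- r | P i) F i) *r b = \sum_(i <- r | P i) F i *r b.
Proof.
by apply: (additive_sum (f := fun m => rmul m b)) => x y; exact: rmulDl.
Qed.
End BalancedSums.

Section DualBasisTensor.
Variables (B D : nzRingType) (s : involution B) (t : involution D) (e : bool).
Variables (h : hform s false) (N : hbimod s t e).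

(** Expand the left factor, move its coefficients across the tensor sign, then expand the right
    factor. *)
Lemma dual_basis_tensform : dual_basis (hval (h := h)) ->
  dual_basis (bval (h := N)) -> dual_basis (hval (h := tensform h N)).
Proof.
move=> [I [m [m' mE]]] [J [n [n' nE]]].
exists (I * J)%type, (fun p => pure (m p.1) (n p.2)), (fun p => pure (m' p.1) (n' p.2)).
have hP := hvalP (tensform h N).
elim/tens_ind => [x y IHx IHy|x y].
  rewrite {1}IHx {1}IHy -big_split; apply: eq_bigr => p _.
  by rewrite (herm_addr hP) rmulDr.
rewrite [in LHS](mE x) pure_suml.
transitivity (\sum_i \sum_j pure (m i) (n j) *r
    hval (pure (m' i) (n' j) : tensform h N) (pure x y)).
  apply: eq_bigr => i _; rewrite pure_bal [in LHS](nE (lact _ y)) pure_sumr.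
  by apply: eq_bigr => j _; rewrite -pureZ /= tval_pure.
by rewrite pair_bigA.
Qed.

End DualBasisTensor.

Section ScalarExtensionTensor.
Variables (B B' D : nzRingType) (s : involution B) (s' : involution B').
Variables (t : involution D) (e : bool).
Variables (f : {rmorphism B -> B'}) (fs : forall a, f (s a) = s' (f a)).
Variables (h : hform s false) (N : hbimod s' t e).
Local Notation V := (tensform (scalext fs h) N).

Lemma dual_basis_scalext : dual_basis (hval (h := h)) ->
  dual_basis (hval (h := scalext fs h)).
Proof.
move=> db; apply: dual_basis_tensform => //.
exists unit, (fun=> 1), (fun=> 1) => x; rewrite big_const card_unit /= addr0.
by rewrite /scal_val inv_fun1 mul1r [RHS](@mul1r B').
Qed.

(** The tensor m (x) 1 (x) n. Such tensors generate [V], which thereby behaves as the tensor product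
    of [h] and [N] over [B]; [cpure_lift] is its universal property. *)
Definition cpure (m : h) (n : N) : V :=
  pure (pure (N := scal_bimod f) m 1 : scalext fs h) n.

Lemma cpureDl m m' n : cpure (m + m') n = cpure m n + cpure m' n.
Proof. by rewrite /cpure -pureDl -(pureDl (N := scal_bimod f)). Qed.
Lemma cpureDr m n n' : cpure m (n + n') = cpure m n + cpure m n'.
Proof. exact: pureDr. Qed.
Lemma cpure_act m (b : B') (n : N) :
  pure (pure (N := scal_bimod f) m b : scalext fs h) n = cpure m (lact b n).
Proof.
rewrite /cpure -pure_bal (pureZ (N := scal_bimod f)).
by rewrite -[1 *r b]/((1 : B') * b) mul1r.
Qed.
Lemma cpure_bal m a n : cpure (m *r a) n = cpure m (lact (f a) n).
Proof.
rewrite -cpure_act {1}/cpure (pure_bal (N := scal_bimod f)); congr (pure (pure _ _) _).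
exact: (@mulr1 B').
Qed.
Lemma cpureZ m n d : cpure m n *r d = cpure m (n *r d).
Proof. exact: pureZ. Qed.
Lemma cpure_val m n m' n' :
  hval (cpure m n) (cpure m' n') = bval n (lact (f (hval m m')) n').
Proof.
rewrite /= tval_pure /= tval_pure /= /scal_val /scal_act inv_fun1 mul1r.
by rewrite mulr1.
Qed.

Lemma cpure_suml I (r : seq I) (P : pred I) (F : I -> h) n :
  cpure (\sum_(i <- r | P i) F i) n = \sum_(i <- r | P i) cpure (F i) n.
Proof. by apply: (additive_sum (f := fun m => cpure m n)) => m m'; exact: cpureDl. Qed.

Lemma cpure_ind (Q : V -> Prop) :
  (forall x y, Q x -> Q y -> Q (x + y)) -> (forall m n, Q (cpure m n)) ->
  forall x, Q x.
Proof.
move=> QD Qp; elim/tens_ind => [x y|y n]; first exact: QD.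
elim/tens_ind: y => [y y' IH IH'|m b]; last by rewrite cpure_act; exact: Qp.
by rewrite pureDl; exact: QD.
Qed.

Lemma cpure_lift (G : zmodType) (phi : h -> N -> G) :
  (forall m m' n, phi (m + m') n = phi m n + phi m' n) ->
  (forall m n n', phi m (n + n') = phi m n + phi m n') ->
  (forall m a n, phi (m *r a) n = phi m (lact (f a) n)) ->
  exists2 Phi : V -> G, forall x y, Phi (x + y) = Phi x + Phi y
    & forall m n, Phi (cpure m n) = phi m n.
Proof.
move=> phiDl phiDr phi_bal.
pose chi (n : N) m (b : scal_bimod f) := phi m (lact (b : B') n).
have chiDl n m m' b : chi n (m + m') b = chi n m b + chi n m' b by exact: phiDl.
have chiDr n m b b' : chi n m (b + b') = chi n m b + chi n m b'.
  by rewrite /chi lactDl phiDr.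
have chi_bal n m a b : chi n (m *r a) b = chi n m (lact a b).
  by rewrite /chi phi_bal /= /scal_act lactM.
pose psi (y : scalext fs h) n := tlift (chi n) y.
have psi_pure m (b : B') (n : N) : psi (pure (N := scal_bimod f) m b) n = phi m (lact b n).
  exact: (tlift_pure (chiDl n) (chiDr n) (chi_bal n)).
have psiDl y y' n : psi (y + y') n = psi y n + psi y' n.
  exact: (tliftD (chiDl n) (chiDr n) (chi_bal n)).
have psiDr y n n' : psi y (n + n') = psi y n + psi y n'.
  elim/tens_ind: y => [y y' IH IH'|m b]; first by rewrite !psiDl IH IH' addrACA.
  by rewrite !psi_pure -phiDr -lactDr.
have psi_bal y a n : psi (y *r a) n = psi y (lact a n).
  elim/tens_ind: y => [y y' IH IH'|m b]; first by rewrite rmulDl !psiDl IH IH'.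
  rewrite (pureZ (N := scal_bimod f)) !psi_pure; congr (phi _ _).
  by rewrite -[b *r a]/((b : B') * a) lactM.
exists (tlift psi) => [x y|m n]; first exact: (tliftD psiDl psiDr psi_bal).
by rewrite (tlift_pure psiDl psiDr psi_bal) psi_pure lact1.
Qed.

End ScalarExtensionTensor.

(** * Nondegeneracy of the trace form *)

Section TraceForm.
Variables (F : fieldType) (L : fieldExtType F).
Hypothesis charF0 : forall n, n.+1%:R != 0 :> F.

Local Notation tr := (@field_trace F L).

Lemma trace1_neq0 : tr 1 != 0.
Proof.
rewrite /field_trace (_ : lin1_mx _ = 1%:M).
  have := adim_gt0 {: L}%AS; rewrite dimvf /= mxtrace1.
  by case: (dim L) => // n _; exact: charF0.
by apply/matrixP => i j; rewrite !mxE /= mul1r r2vK !mxE eqxx eq_sym.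
Qed.

(** Nondegeneracy holds because Tr(x x^-1) = Tr(1) is the degree of [L], nonzero in characteristic
    0. The dual family is read off the inverse of the Gram matrix [T]. *)
Lemma trace_dual_basis : exists u : 'I_(dim L) -> L,
  forall x, x = \sum_i tr (u i * x) *: ext_basis i.
Proof.
pose T : 'M[F]_(dim L) := \matrix_(i, j) tr (ext_basis i * ext_basis j).
have trE (v : 'rV_(dim L)) y : tr ((\sum_i v 0 i *: ext_basis i) * y)
    = \sum_i v 0 i * tr (ext_basis i * y).
  rewrite mulr_suml (additive_sum (@field_traceD F L)).
  by apply: eq_bigr => i _; rewrite -scalerAl field_traceZ.
have Tu : T \in unitmx.
  (* A row of the kernel of [T] holds the coordinates of an x with Tr(x y) = 0 for all y. *)
  rewrite -row_free_unit -kermx_eq0; apply/eqP/row_matrixP => l.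
  set v := row l _; rewrite row0.
  have vT : v *m T = 0 by rewrite /v -row_mul mulmx_ker row0.
  pose x := \sum_i v 0 i *: (ext_basis i : L).
  have trx y : tr (x * y) = 0.
    rewrite (ext_basisE y) mulr_sumr (additive_sum (@field_traceD F L)).
    rewrite big1 // => j _; rewrite -scalerAr field_traceZ trE.
    move/rowP/(_ j): vT; rewrite !mxE => vT; rewrite (_ : \sum_i _ = 0) ?mulr0 //.
    by rewrite -[RHS]vT; apply: eq_bigr => i _; rewrite !mxE.
  have x0 : x = 0.
    apply/eqP/negP => /negP xn0; have := trx x^-1.
    by rewrite mulfV // => /eqP; rewrite (negPf trace1_neq0).
  have -> : v = v2r x.
    rewrite /x linear_sum /= [LHS]row_sum_delta; apply: eq_bigr => i _.
    by rewrite linearZ /= r2vK.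
  by rewrite x0 linear0.
exists (fun k => \sum_i (invmx T) k i *: ext_basis i) => x.
rewrite {1}(ext_basisE x); apply: eq_bigr => k _; congr (_ *: _).
have -> : \sum_i invmx T k i *: (ext_basis i : L) =
    \sum_i (row k (invmx T)) 0 i *: ext_basis i.
  by apply: eq_bigr => i _; rewrite !mxE.
rewrite trE.
have trx i : tr (ext_basis i * x) = \sum_j v2r x 0 j * T i j.
  rewrite {1}(ext_basisE x) mulr_sumr (additive_sum (@field_traceD F L)).
  by apply: eq_bigr => j _; rewrite -scalerAr field_traceZ mxE.
transitivity ((v2r x *m T^T *m (invmx T)^T) 0 k).
  by rewrite -mulmxA -trmx_mul mulVmx // trmx1 mulmx1.
rewrite mxE; apply: eq_bigr => i _; rewrite !mxE mulrC trx; congr (_ * _).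
by apply: eq_bigr => j _; rewrite !mxE.
Qed.

End TraceForm.

(** * The action of L (x) K on the transferred form *)

Lemma ext_inv_scalar (F K : fieldType) (A : falgType F) (iota : {rmorphism F -> K})
  (sigma : alg_involution A) (c : K) : ext_inv iota sigma c%:A = c%:A.
Proof.
rewrite -[LHS]/(ext_inv_fun sigma (c *: extin iota 1)) linearZ /=.
by rewrite ext_inv_extin inv_fun1.
Qed.

Section TransferDualBasis.
Variables (F : fieldType) (A : falgType F) (sigma : alg_involution A).
Variables (L : fieldExtType F).
Hypothesis charF0 : forall n, n.+1%:R != 0 :> F.
Variable h : hform (ext_inv (in_alg L) sigma) false.
Let hP := hvalP h.

(** The dual bases of [h] and of the trace form multiply: each coefficient in A (x) L is expanded
    along the basis of [L]. *)
Lemma dual_basis_transfer : dual_basis (hval (h := h)) ->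
  dual_basis (hval (h := transfer h)).
Proof.
move=> [I [m [m' mE]]]; have [u uE] := trace_dual_basis L charF0.
have yE (y : ext A (in_alg L)) :
    y = \sum_k ext_basis k *: extin (in_alg L) (ext_trace (u k *: y)).
  elim/ext_ind: y => [y y' IH IH'||c a].
  - rewrite {1}IH {1}IH' -big_split; apply: eq_bigr => k _.
    by rewrite scalerDr ext_traceD raddfD scalerDr.
  - by rewrite big1 // => k _; rewrite scaler0 ext_trace0 raddf0 scaler0.
  rewrite [in LHS](uE c) scaler_suml; apply: eq_bigr => k _.
  by rewrite scalerA ext_trace_pure extinZ scalerA /= mulr_algr.
exists (I * 'I_(dim L))%type, (fun p => m p.1 *r (ext_basis p.2)%:A : h),
  (fun p => m' p.1 *r (u p.2)%:A : h) => x.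
rewrite [LHS]mE.
transitivity (\sum_i \sum_k m i *r (ext_basis k *: extin (in_alg L)
    (ext_trace (u k *: hval (m' i) x))) : h).
  by apply: eq_bigr => i _; rewrite {1}[hval _ _]yE rmul_sumr.
rewrite pair_bigA; apply: eq_bigr => -[i k] _ /=.
rewrite /transfer_val (herm_mull hP) ext_inv_scalar mulr_algl.
by rewrite -[RHS]/((m i *r (ext_basis k)%:A : h) *r extin (in_alg L) _) rmulA mulr_algl.
Qed.

End TransferDualBasis.

Section FieldAction.
Variables (F : fieldType) (A : falgType F) (sigma : alg_involution A).
Variables (L : fieldExtType F) (K : fieldType) (iota : {rmorphism F -> K}).
Variables (k : kind) (e : bool) (M : morita (ext_inv iota sigma) k e).
Variable h : hform (ext_inv (in_alg L) sigma) false.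

Local Notation AL := (ext A (in_alg L)).
Local Notation AK := (ext A iota).
Local Notation N := (hbcar M).
Local Notation jL := (extin (A := A) (in_alg L)).
Local Notation jK := (extin (A := A) iota).
Local Notation D := (Dring k K).

Definition morita_transfer : hform (Dinv k K) e :=
  tensform (scalext (f := jK : {rmorphism A -> AK}) (extin_inv sigma iota) (transfer h)) M.
Local Notation V := morita_transfer.

Definition tpure (m : h) (n : N) : V :=
  cpure (extin_inv sigma iota) (h := transfer h) (N := M) m n.

Lemma tpureDl m m' n : tpure (m + m') n = tpure m n + tpure m' n.
Proof. exact: (cpureDl (extin_inv sigma iota) (h := transfer h)). Qed.
Lemma tpureDr m n n' : tpure m (n + n') = tpure m n + tpure m n'.
Proof. exact: cpureDr. Qed.
Lemma tpure_bal m a n : tpure (m *r jL a) n = tpure m (lact (jK a) n).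
Proof. exact: (cpure_bal (extin_inv sigma iota) (h := transfer h)). Qed.
Lemma tpureZ m n d : tpure m n *r d = tpure m (n *r d).
Proof. exact: cpureZ. Qed.
Lemma tpure_val m n m' n' : hval (tpure m n) (tpure m' n') =
  bval n (lact (jK (ext_trace (hval m m'))) n').
Proof. exact: cpure_val. Qed.
Lemma tpure_ind (Q : V -> Prop) :
  (forall x y, Q x -> Q y -> Q (x + y)) -> (forall m n, Q (tpure m n)) ->
  forall x, Q x.
Proof. exact: cpure_ind. Qed.
Lemma tpure_suml I (r : seq I) (P : pred I) (f : I -> h) n :
  tpure (\sum_(i <- r | P i) f i) n = \sum_(i <- r | P i) tpure (f i) n.
Proof. exact: (cpure_suml (extin_inv sigma iota) (h := transfer h)). Qed.

Lemma lact_alg_comm (c : K) (x : AK) (n : N) :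
  lact c%:A (lact x n) = lact x (lact c%:A n).
Proof. by rewrite -!lactM mulr_algl mulr_algr. Qed.

(** Basis vectors of [L] act on [m] and coordinates of [z] on [n]. This is balanced over [A] since L
    and K are central in A (x) L and A (x) K. *)
Lemma field_act_ex (z : ext L iota) :
  exists2 Phi : V -> V, forall x y, Phi (x + y) = Phi x + Phi y
    & forall m n, Phi (tpure m n) =
        \sum_i tpure (m *r (ext_basis i)%:A) (lact (z 0 i)%:A n).
Proof.
apply: (cpure_lift (extin_inv sigma iota) (h := transfer h) (N := M)
   (phi := fun (m : h) n => \sum_i tpure (m *r (ext_basis i)%:A) (lact (z 0 i)%:A n))).
- move=> m m' n; rewrite -big_split; apply: eq_bigr => i _.
  by rewrite rmulDl tpureDl.
- move=> m n n'; rewrite -big_split; apply: eq_bigr => i _.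
  by rewrite lactDr tpureDr.
move=> m a n; apply: eq_bigr => i _.
rewrite lact_alg_comm -tpure_bal; congr tpure.
by rewrite -[X in X *r _]/((m : h) *r jL a) !rmulA mulr_algl mulr_algr.
Qed.

Definition field_act (z : ext L iota) : V -> V := s2val (cid2 (field_act_ex z)).

Lemma field_actD z x y : field_act z (x + y) = field_act z x + field_act z y.
Proof. exact: (s2valP (cid2 (field_act_ex z))). Qed.

Lemma field_act_tpure z m n : field_act z (tpure m n) =
  \sum_i tpure (m *r (ext_basis i)%:A) (lact (z 0 i)%:A n).
Proof. exact: (s2valP' (cid2 (field_act_ex z))). Qed.

(** The coordinates of [l] lie in F and cross the tensor sign, so the basis used to define the
    action drops out. *)
Lemma field_actE c l m n : field_act (c *: extin iota l) (tpure m n) =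
  tpure (m *r l%:A) (lact c%:A n).
Proof.
rewrite field_act_tpure [in RHS](ext_basisE l) scaler_suml rmul_sumr tpure_suml.
apply: eq_bigr => i _.
have -> : (v2r l 0 i *: ext_basis i)%:A = (ext_basis i)%:A * jL (v2r l 0 i)%:A :> AL.
  by rewrite extinZ rmorph1 mulr_algl scalerA /= mulr_algr.
rewrite -rmulA tpure_bal extinZ rmorph1 -lactM mulr_algl scalerA.
by rewrite !mxE mulrC.
Qed.

Lemma field_actDl z z' x : field_act (z + z') x = field_act z x + field_act z' x.
Proof.
elim/tpure_ind: x => [x y IH IH'|m n]; first by rewrite !field_actD IH IH' addrACA.
rewrite !field_act_tpure -big_split; apply: eq_bigr => i _.
by rewrite mxE scalerDl lactDl tpureDr.
Qed.

Lemma field_act0 x : field_act 0 x = 0.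
Proof. by apply: (addrI (field_act 0 x)); rewrite -field_actDl !addr0. Qed.

Lemma field_actM z z' x : field_act (z * z') x = field_act z (field_act z' x).
Proof.
elim/tpure_ind: x => [x y IH IH'|m n]; first by rewrite !field_actD IH IH'.
elim/ext_ind: z => [z1 z2 IH IH'||c l].
- by rewrite mulrDl !field_actDl IH IH'.
- by rewrite mul0r !field_act0.
elim/ext_ind: z' => [z1 z2 IH IH'||c' l'].
- by rewrite mulrDr !field_actDl IH IH' field_actD.
- by rewrite mulr0 field_act0 (additive0 (field_actD _)).
rewrite -scalerAl -scalerAr -rmorphM scalerA !field_actE.
rewrite rmulA -lactM !mulr_algl !scalerA; congr (tpure (_ *r (_ *: _)) _).
exact: mulrC.
Qed.

Lemma field_act1 x : field_act 1 x = x.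
Proof.
elim/tpure_ind: x => [x y IH IH'|m n]; first by rewrite field_actD IH IH'.
rewrite -[1 in LHS](scale1r (extin iota (1 : L))) field_actE !scale1r.
by rewrite lact1 rmul1.
Qed.

Lemma field_actZ z x d : field_act z (x *r d) = field_act z x *r d.
Proof.
elim/tpure_ind: x => [x y IH IH'|m n].
  by rewrite rmulDl !field_actD IH IH' rmulDl.
rewrite tpureZ !field_act_tpure rmul_suml; apply: eq_bigr => i _.
by rewrite tpureZ lactC.
Qed.

Lemma field_act_scalar c z m n :
  field_act (c *: z) (tpure m n) = field_act z (tpure m (lact c%:A n)).
Proof.
rewrite !field_act_tpure; apply: eq_bigr => i _; rewrite mxE.
by rewrite -lactM mulr_algl scalerA mulrC.
Qed.

(** Scalars from L and K are central and fixed by sigma (x) id. *)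
Lemma field_act_adj z x y : hval (field_act z x) y = hval x (field_act z y).
Proof.
have hVP := hvalP V; have hP := hvalP h.
elim/tpure_ind: x => [x x' IH IH'|m n].
  by rewrite field_actD !(herm_addl hVP) IH IH'.
elim/tpure_ind: y => [y y' IH IH'|m' n'].
  by rewrite field_actD !(herm_addr hVP) IH IH'.
elim/ext_ind: z => [z1 z2 IH IH'||c l].
- by rewrite !field_actDl (herm_addl hVP) (herm_addr hVP) IH IH'.
- by rewrite !field_act0 (herm0l hVP) (herm0r hVP).
rewrite !field_actE !tpure_val bval_adj ext_inv_scalar lact_alg_comm.
by rewrite (herm_mull hP) (herm_mulr hP) ext_inv_scalar mulr_algl mulr_algr.
Qed.

End FieldAction.

(** Complete the square: p = (X + a)^2 + d. Irreducibility forces d > 0, and (X + a) / sqrt d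
    squares to -1 modulo p. *)
Lemma quadratic_extension_sqrt_opp1 (K : rcfType) (p : {poly K})
    (mi : monic_irreducible_poly p) : size p = 3 ->
  exists y : {poly %/ p with mi}, y * y = -1.
Proof.
move=> sp; have [[_ irr] mon] := mi.
set b := p`_1; set c := p`_0.
have pE : p = 'X^2 + b *: 'X + c%:P.
  apply/polyP => i; rewrite !coefD coefXn coefZ coefX coefC.
  case: i => [|[|[|i]]] /=; rewrite ?mulr0 ?mulr1 ?addr0 ?add0r //.
    by have := monicP mon; rewrite lead_coefE sp.
  by rewrite nth_default // sp.
pose a := b / 2%:R; pose d := c - a ^+ 2.
have bE : b = a + a by rewrite /a -mulr2n -[RHS]mulr_natr divfK ?Num.Theory.pnatr_eq0.
have pdE : p = ('X + a%:P) ^+ 2 + d%:P.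
  rewrite pE -mul_polyC bE (_ : c = d + a * a); last by rewrite subrK.
  by rewrite !polyCD polyCM; ring.
have dE u : p.[u] = (u + a) ^+ 2 + d.
  by rewrite pdE hornerD horner_exp hornerD hornerX !hornerC.
have d0 : 0 < d.
  rewrite Order.TotalTheory.ltNge; apply/negP => d0.
  (* If d <= 0, then sqrt(-d) - a is a root, giving a linear factor. *)
  have /irr : size ('X - (Num.sqrt (- d) - a)%:P) != 1%N by rewrite size_XsubC.
  rewrite dvdp_XsubCl rootE dE subrK Num.Theory.sqr_sqrtr ?Num.Theory.oppr_ge0 //.
  by rewrite addNr eqxx => /(_ isT) /eqp_size; rewrite size_XsubC sp.
pose s := Num.sqrt d.
have s2 : s ^+ 2 = d by rewrite Num.Theory.sqr_sqrtr // Order.POrderTheory.ltW.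
have s0 : s != 0 by rewrite -sqrf_eq0 s2 Num.Theory.lt0r_neq0.
pose q := s^-1 *: ('X + a%:P).
have qE : q * q = d^-1 *: p - 1.
  rewrite /q -scalerAl -scalerAr scalerA -invfM -expr2 s2 {1}pdE scalerDr.
  by rewrite -[_ *: d%:P]mul_polyC -polyCM mulVf ?addrK // -s2 sqrf_eq0.
exists (in_qpoly p q).
rewrite -rmorphM /= qE raddfB /= in_qpoly1 in_qpolyZ.
suff -> : in_qpoly p p = 0 by rewrite scaler0 sub0r.
apply: val_inj; rewrite /= mk_monicE //; by rewrite -Pdiv.IdomainMonic.modpE ?modpp.
Qed.

(** * Idempotents of L (x) K *)

Section ExtendedTrace.
Variables (F K : fieldType) (L : fieldExtType F) (iota : {rmorphism F -> K}).
Local Notation LK := (ext L iota).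

Definition ktrace (z : LK) : K := \sum_i z 0 i * iota (field_trace (ext_basis i)).

Lemma ktraceD x y : ktrace (x + y) = ktrace x + ktrace y.
Proof. by rewrite -big_split; apply: eq_bigr => i _; rewrite mxE mulrDl. Qed.
Lemma ktraceZ c x : ktrace (c *: x) = c * ktrace x.
Proof. by rewrite mulr_sumr; apply: eq_bigr => i _; rewrite mxE mulrA. Qed.

Lemma ktrace_extin l : ktrace (extin iota l) = iota (field_trace l).
Proof.
rewrite [in RHS](ext_basisE l) (additive_sum (@field_traceD F L)) rmorph_sum.
by apply: eq_bigr => i _; rewrite field_traceZ rmorphM mxE.
Qed.

(** The right side is the trace of multiplication by [z] in the K-basis coming from [L]. Both sides
    are K-linear and agree on [L]. *)
Lemma ktrace_mul z : ktrace z = \sum_i (z * extin iota (ext_basis i)) 0 i.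
Proof.
elim/ext_ind: z => [x y IH IH'||c l].
- rewrite ktraceD IH IH' -big_split; apply: eq_bigr => i _.
  by rewrite mulrDl mxE.
- rewrite (additive0 ktraceD) big1 // => i _.
  by rewrite mul0r mxE.
rewrite ktraceZ ktrace_extin /field_trace /mxtrace rmorph_sum mulr_sumr.
by apply: eq_bigr => i _; rewrite -scalerAl -rmorphM !mxE.
Qed.

Lemma ext_mulC (x y : LK) : x * y = y * x.
Proof.
elim/ext_ind: x => [x x' IH IH'||c l].
- by rewrite mulrDl mulrDr IH IH'.
- by rewrite mul0r mulr0.
elim/ext_ind: y => [y y' IH IH'||d m].
- by rewrite mulrDl mulrDr IH IH'.
- by rewrite mul0r mulr0.
by rewrite -!(scalerAl, scalerAr) -!rmorphM mulrC !scalerA [in RHS]mulrC.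
Qed.

End ExtendedTrace.

Section Idempotents.
Variables (F K : fieldType) (L : fieldExtType F) (iota : {rmorphism F -> K}).
Variable S : splitting L iota.
Local Notation LK := (ext L iota).
Local Notation r := (sp_r S).

Lemma omega_ex (y : forall i, sp_field (S := S) i) :
  exists x : LK, forall i, omega i x = y i.
Proof. by have [x [xE _]] := sp_bij (s := S) y; exists x. Qed.

Lemma omega_inj (x y : LK) : (forall i : 'I_(sp_t S), omega i x = omega i y) -> x = y.
Proof.
move=> xy; have [z [zE zU]] := sp_bij (s := S) (fun i => omega i y).
by rewrite -(zU x xy) -(zU y (fun=> erefl)).
Qed.

Lemma omegaZ (i : 'I_(sp_t S)) c x : omega i (c *: x) = omega_iota0 i c * omega i x.
Proof. by rewrite -[c *: x]mulr_algl rmorphM. Qed.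

Definition idem (i : 'I_r) : LK :=
  sval (cid (omega_ex (fun j => (j == sp_lin i)%:R))).

Lemma omega_idem i j : omega j (idem i) = (j == sp_lin i)%:R.
Proof. exact: svalP (cid (omega_ex _)) j. Qed.

Lemma sp_lin_inj : injective (@sp_lin _ _ _ _ S).
Proof. by move=> i j /(congr1 val) /= ij; apply: val_inj. Qed.

(* L (x)_F K acts on idem i * (L (x)_F K) through the i-th projection to K. *)
Definition kproj (i : 'I_r) (z : LK) : K := iso_inv (omega_iota0_bij i) (omega (sp_lin i) z).

Lemma kprojZ i c z : kproj i (c *: z) = c * kproj i z.
Proof. by rewrite /kproj omegaZ rmorphM /= iso_invK'. Qed.

Lemma kprojD i x y : kproj i (x + y) = kproj i x + kproj i y.
Proof. by rewrite /kproj !rmorphD. Qed.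

Lemma idem_mul i z : idem i * z = kproj i z *: idem i.
Proof.
apply: omega_inj => j; rewrite rmorphM /= omegaZ omega_idem.
have [->|_] := eqVneq j (sp_lin i); last by rewrite mul0r mulr0.
by rewrite mul1r mulr1 /kproj iso_invK.
Qed.

Lemma kproj_idem i : kproj i (idem i) = 1.
Proof. by rewrite /kproj omega_idem eqxx rmorph1. Qed.

Lemma idem_mul_idem i j : idem i * idem j = if i == j then idem i else 0.
Proof.
rewrite idem_mul /kproj omega_idem (inj_eq sp_lin_inj).
by case: eqP => [->|_]; rewrite ?rmorph1 ?scale1r // rmorph0 scale0r.
Qed.

(* idem i has rank one as an endomorphism of L (x)_F K. *)
Lemma ktrace_idem i : ktrace (idem i) = 1.
Proof.
rewrite ktrace_mul -[RHS](kproj_idem i) [in RHS](ext_eqE (idem i)).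
rewrite (additive_sum (kprojD i)); apply: eq_bigr => j _.
by rewrite kprojZ idem_mul mxE mulrC.
Qed.

Lemma ktrace_idem_mul i z : ktrace (idem i * z) = kproj i z.
Proof. by rewrite idem_mul ktraceZ ktrace_idem mulr1. Qed.

(** The idempotent of the product of the quadratic factors. *)
Definition coidem : LK := 1 - \sum_i idem i.

Lemma omega_coidem (j : 'I_(sp_t S)) : omega j coidem = (r <= j)%:R.
Proof.
rewrite rmorphB rmorph1 rmorph_sum /=.
under eq_bigr do rewrite omega_idem.
have [rj|jr] := leqP r j.
  rewrite big1 ?subr0 // => i _; case: eqP rj => // ->.
  by rewrite leqNgt [(_ < r)%N](ltn_ord i).
have [i ->] : exists i, j = sp_lin i by exists (Ordinal jr); exact: val_inj.
rewrite (bigD1 i) //= eqxx big1 ?addr0 ?subrr // => l li.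
by rewrite (inj_eq sp_lin_inj) eq_sym (negPf li).
Qed.

Lemma coidem_mul : coidem * coidem = coidem.
Proof.
apply: omega_inj => j; rewrite rmorphM /= omega_coidem.
by case: (_ <= _)%N; rewrite ?mulr1 ?mulr0.
Qed.

Lemma coidem_idem i : coidem * idem i = 0.
Proof.
apply: omega_inj => j; rewrite rmorphM rmorph0 /= omega_coidem omega_idem.
have [->|_] := eqVneq j (sp_lin i); last exact: mulr0.
by rewrite leqNgt [(_ < r)%N](ltn_ord i) mul0r.
Qed.

End Idempotents.

(** J is glued from components: 0 at a linear factor, a square root of -1 at a quadratic one. *)
Lemma coidem_sqrt_opp1 (F : fieldType) (K : rcfType) (L : fieldExtType F)
    (iota : {rmorphism F -> K}) (S : splitting L iota) :
  exists J : ext L iota, J * J = - coidem S /\ coidem S * J = J.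
Proof.
have yex (j : 'I_(sp_t S)) : exists y : sp_field j,
    y * y = - omega j (coidem S) /\ omega j (coidem S) * y = y.
  rewrite omega_coidem; have [rj|jr] := leqP (sp_r S) j; last first.
    by exists 0; rewrite mulr0 oppr0.
  have sz : size (sp_fac j) = 3 by rewrite sp_size ltnNge rj.
  have [y yE] := quadratic_extension_sqrt_opp1 (sp_mi j) sz.
  by exists y; rewrite mul1r.
have [J JE] := omega_ex (fun j => sval (cid (yex j))).
have yE j := svalP (cid (yex j)).
exists J; split; apply: (omega_inj (S := S)) => j; rewrite rmorphM /= JE.
  by rewrite rmorphN (yE j).1.
exact: (yE j).2.
Qed.

(** * The pieces e_i V and the summands on the right-hand side *)

Section Branches.
Variables (F : fieldType) (A : falgType F) (sigma : alg_involution A).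
Variables (L : fieldExtType F) (K : fieldType) (iota : {rmorphism F -> K}).
Variables (S : splitting L iota) (k : kind) (e : bool).
Variables (M : morita (ext_inv iota sigma) k e).
Variable h : hform (ext_inv (in_alg L) sigma) false.
Local Notation AL := (ext A (in_alg L)).
Local Notation AK := (ext A iota).
Local Notation N := (hbcar M).
Local Notation jL := (extin (A := A) (in_alg L)).
Local Notation jK := (extin (A := A) iota).
Local Notation V := (morita_transfer M h).
Let hP := hvalP h.
Let bP := bvalP M.

Section Branch.
Variable i : 'I_(sp_r S).

Local Notation kappa := (omega_iota1 (sp_lin i)).
Local Notation rho' := (iso_inv (omega_iota0_bij i)).

(** Base change along the i-th real closure, brought back to A (x) K by the inverse of the
    isomorphism of K with F_i. *)
Definition branch_map (x : AL) : AK :=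
  extmap (iso_inv_comp (omega_iota0_bij i) (omega_compat (sp_lin i)))
    (extmap (iota := in_alg L) (iota' := kappa \o in_alg L) (rho := kappa)
      (fun=> erefl) x).

Lemma branch_mapE l a :
  branch_map (l *: jL a) = kproj i (extin iota l) *: jK a.
Proof. by rewrite /branch_map extmapZ extmap_extin extmapZ extmap_extin. Qed.

Lemma branch_mapD x y : branch_map (x + y) = branch_map x + branch_map y.
Proof. by rewrite /branch_map !raddfD. Qed.

(* As idem i has trace 1 and is a K-eigenvector, the trace form restricted   *)
(* to idem i * (L (x)_F K) is evaluation at the i-th ordering.               *)
Lemma branch_map_trace x : branch_map x =
  \sum_j idem i 0 j *: jK (ext_trace (ext_basis j *: x)).
Proof.
elim/ext_ind: x => [x y IH IH'||l a].
- rewrite branch_mapD IH IH' -big_split; apply: eq_bigr => j _.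
  by rewrite scalerDr ext_traceD raddfD scalerDr.
- rewrite (additive0 branch_mapD) big1 // => j _.
  by rewrite scaler0 ext_trace0 raddf0 scaler0.
rewrite branch_mapE -ktrace_idem_mul [in LHS](ext_eqE (idem i)) mulr_suml.
rewrite (additive_sum (@ktraceD _ _ L iota)) scaler_suml; apply: eq_bigr => j _.
rewrite -scalerAl -rmorphM ktraceZ ktrace_extin.
by rewrite [_ *: (l *: _)]scalerA ext_trace_pure extinZ scalerA.
Qed.

(** Expanding e_i along the basis of L gives a K-combination of transferred values, which
    [branch_map_trace] sums to the value of [h] at the i-th ordering. *)
Lemma idem_val (m : h) (n : N) (m' : h) (n' : N) :
  hval (field_act (idem i) (tpure (M := M) m n)) (tpure (M := M) m' n') =
  bval n (lact (branch_map (hval m m')) n').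
Proof.
rewrite field_act_tpure (herm_suml (hvalP V)) branch_map_trace lact_suml.
rewrite (herm_sumr bP); apply: eq_bigr => j _.
rewrite tpure_val bval_adj ext_inv_scalar -lactM mulr_algl.
by rewrite (herm_mull hP) ext_inv_scalar mulr_algl.
Qed.

Definition branch_morita := ext_transport (omega_iota0_bij i) (omega_compat (sp_lin i)) M.

Definition branch : hform (Dinv k (sp_field (sp_lin i))) e :=
  tensform (scalext (extmap_inv (iota := in_alg L) (iota' := kappa \o in_alg L)
    (rho := kappa) (fun=> erefl) sigma) h) branch_morita.

(** The map sends m (x) n to e_i (m (x) n). It is balanced since L acts on e_i V through the scalars
    [kproj i], and isometric by [idem_val]. *)
Lemma branch_embedding : exists Psi : branch -> V,
  [/\ forall x y, Psi (x + y) = Psi x + Psi y,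
      forall x d, Psi (x *r d) = Psi x *r Dmap k rho' d,
      forall x y, hval (Psi x) (Psi y) = Dmap k rho' (hval x y),
      forall x, field_act (idem i) (Psi x) = Psi x
    & forall y, exists x, field_act (idem i) y = Psi x].
Proof.
have idemK x : field_act (idem i) (field_act (idem i) x) = field_act (idem i) x :> V.
  by rewrite -field_actM idem_mul_idem eqxx.
have [|||Psi PsiD PsiE] := cpure_lift (extmap_inv (iota := in_alg L)
    (iota' := kappa \o in_alg L) (rho := kappa) (fun=> erefl) sigma) (h := h) (N := branch_morita)
    (phi := fun m n => field_act (idem i) (tpure (M := M) m (n : N))).
- by move=> m m' n; rewrite tpureDl field_actD.
- by move=> m n n'; rewrite -field_actD -tpureDr.
- move=> m x n; rewrite -[lact _ _]/(lact (branch_map x) (n : N)).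
  pose g1 x := field_act (idem i) (tpure (M := M) (m *r x) n).
  pose g2 x := field_act (idem i) (tpure (M := M) m (lact (branch_map x) n)).
  have g1D x' y : g1 (x' + y) = g1 x' + g1 y.
    by rewrite /g1 rmulDr tpureDl field_actD.
  have g2D x' y : g2 (x' + y) = g2 x' + g2 y.
    by rewrite /g2 branch_mapD lactDl tpureDr field_actD.
  rewrite -[LHS]/(g1 x) -[RHS]/(g2 x).
  elim/ext_ind: x => [x y IH IH'||l a]; first by rewrite g1D g2D IH IH'.
    by rewrite (additive0 g1D) (additive0 g2D).
  rewrite /g1 /g2 branch_mapE -[l *: jL a]mulr_algl -[_ *: jK a]mulr_algl -rmulA.
  rewrite tpure_bal lactM -field_act_scalar -idem_mul field_actM.
  by rewrite -[extin iota l]scale1r field_actE scale1r lact1.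
exists Psi; split=> //.
- elim/cpure_ind => [x y IH IH'|m n] d; first by rewrite rmulDl !PsiD IH IH' rmulDl.
  by rewrite cpureZ !PsiE -field_actZ tpureZ.
- move=> x y; elim/cpure_ind: x => [x x' IH IH'|m n].
    by rewrite PsiD (herm_addl (hvalP V)) (herm_addl (hvalP branch)) IH IH' rmorphD.
  elim/cpure_ind: y => [y y' IH IH'|m' n'].
    by rewrite PsiD (herm_addr (hvalP V)) (herm_addr (hvalP branch)) IH IH' rmorphD.
  rewrite !PsiE -field_act_adj idemK idem_val cpure_val.
  rewrite -[lact _ n' in RHS]/(lact (branch_map (hval m m')) (n' : N)).
  by rewrite /= /tr_val (Dmap_can (iso_invK' (omega_iota0_bij i))).
- elim/cpure_ind => [x y IH IH'|m n]; first by rewrite PsiD field_actD IH IH'.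
  by rewrite PsiE.
elim/tpure_ind => [x y [x' xE] [y' yE]|m n].
  by exists (x' + y'); rewrite field_actD PsiD xE yE.
by exists (cpure _ (N := branch_morita) m (n : N)); rewrite PsiE.
Qed.

End Branch.
End Branches.

(** * The signature of the transferred form *)

Lemma sign_eq0 (k : kind) (K : fieldType) (e : bool) (g : hform (Dinv k K) e) :
  k = DExch \/ e = true -> sign g = 0.
Proof. by case: k e g => [] [] g // []. Qed.

Lemma sign_diag (k : kind) (K : fieldType) (g : hform (Dinv k K) false) :
  k <> DExch -> sign g = diag_sign g.
Proof. by case: k g. Qed.

Section SignatureSum.
Variables (F : fieldType) (A : falgType F) (sigma : alg_involution A).
Variables (L : fieldExtType F) (K : rcfType) (iota : {rmorphism F -> K}).
Variables (S : splitting L iota) (k : kind).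
Variables (M : morita (ext_inv iota sigma) k false).
Variable h : hform (ext_inv (in_alg L) sigma) false.
Hypothesis kE : k <> DExch.
Hypothesis hns : nonsingular_hform h.

Local Notation V := (morita_transfer M h).
Local Notation act := (@field_act F A sigma L K iota k false M h).
Local Notation r := (sp_r S).
Let hVP := hvalP V.

Lemma charF0 n : n.+1%:R != 0 :> F.
Proof. by rewrite -(fmorph_eq0 iota) rmorph_nat Num.Theory.pnatr_eq0. Qed.

Lemma dual_basis_h : dual_basis (hval (h := h)).
Proof. exact: nonsingular_dual_basis (nsh_fgproj hns) (nsh_nonsing hns). Qed.

Lemma dual_basis_morita_transfer : dual_basis (hval (h := V)).
Proof.
apply: dual_basis_tensform; last first.
  exact: nonsingular_dual_basis (mor_fgproj M) (@mor_nonsing _ _ _ _ _ M).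
exact/dual_basis_scalext/(dual_basis_transfer charF0)/dual_basis_h.
Qed.

Lemma act_opp z x : act (- z) x = - act z x.
Proof.
by apply/eqP; rewrite -addr_eq0 -field_actDl addNr field_act0.
Qed.

(** An orthonormal basis of the branch, carried into V by [branch_embedding]. The index type is
    packed with the data so that a single choice covers all [i]. *)
Lemma branch_basis (i : 'I_r) :
  exists X : {I : finType & ((I -> V) * (I -> bool))%type},
  let v := (projT2 X).1 in let a := (projT2 X).2 in
  [/\ orthonormal v a, forall j, act (idem i) (v j) = v j,
      forall x, spans v (act (idem i) x)
    & sign (branch M h i) = \sum_j (-1) ^+ a j].
Proof.
set rho' := iso_inv (omega_iota0_bij i).
have tpos : positive_inv (Dinv k (sp_field (sp_lin i))).
  apply: (positive_inv_iso (g := Dmap k (omega_iota0 (sp_lin i))) (g' := Dmap k rho')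
    _ _ _ (@positive_inv_Dinv K k kE)).
  - exact/Dmap_can/iso_invK'.
  - exact/Dmap_can/iso_invK.
  - exact: Dmap_inv.
have db : dual_basis (hval (h := branch M h i)).
  apply: dual_basis_tensform; last first.
    exact: nonsingular_dual_basis
      (mor_fgproj (branch_morita M i)) (@mor_nonsing _ _ _ _ _ (branch_morita M i)).
  exact/dual_basis_scalext/dual_basis_h.
have [I [v [a [va vs sE]]]] := diag_sign_orthonormal tpos db.
have [Psi [PsiD PsiZ Psival Psifix Psisurj]] := branch_embedding M h i.
exists (existT _ I (fun j => Psi (v j), a)) => /=; split=> [j l|j|x|].
- by rewrite Psival va; case: eqP; rewrite ?rmorph_sign ?rmorph0.
- exact: Psifix.
- have [y ->] := Psisurj x; have [c ->] := vs y.
  exists (fun j => Dmap k rho' (c j)); rewrite (additive_sum PsiD).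
  by apply: eq_bigr => j _; rewrite PsiZ.
- by rewrite sign_diag.
Qed.

Lemma act_orthogonal z z' x y : z * z' = 0 -> act z x = x -> act z' y = y ->
  hval x y = 0.
Proof.
move=> zz' xE yE; rewrite -xE -yE field_act_adj -field_actM zz' field_act0.
exact: (herm0r hVP).
Qed.

Lemma diag_sign_morita_transfer :
  diag_sign V = \sum_(i < r) sign (branch M h i).
Proof.
have tpos := @positive_inv_Dinv K k kE.
have /choice[X XP] := branch_basis.
have [J [JJ EJ]] := coidem_sqrt_opp1 S.
set E0 := coidem S in JJ EJ.
have E0E0 x : act E0 (act E0 x) = act E0 x by rewrite -field_actM coidem_mul.
have [I0 [w [b [wb wE ws]]]] := orthonormal_basis tpos (field_actD E0) (field_actZ E0)
  E0E0 (field_act_adj E0) dual_basis_morita_transfer.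
pose I i := projT1 (X i).
pose v i : I i -> V := (projT2 (X i)).1.
pose a i : I i -> bool := (projT2 (X i)).2.
have {}XP i : [/\ orthonormal (v i) (a i), forall j, act (idem i) (v i j) = v i j,
    forall x, spans (v i) (act (idem i) x)
  & sign (branch M h i) = \sum_j (-1) ^+ a i j] := XP i.
(* Any orthonormal basis of the remainder, joined to those of the e_i V, is one of V and so computes
   its signature. *)
have total (u : I0 -> V) (c : I0 -> bool) : orthonormal u c ->
    (forall j, act E0 (u j) = u j) -> (forall x, spans u (act E0 x)) ->
    diag_sign V = \sum_(i < r) sign (branch M h i) + \sum_j (-1) ^+ c j.
  move=> uc uE us.
  pose T := [the finType of ({i : 'I_r & I i} + I0)%type].
  pose y (x : T) := match x with inl p => v _ (tagged p) | inr j => u j end.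
  pose d (x : T) := match x with inl p => a _ (tagged p) | inr j => c j end.
  have vE i j : act (idem i) (v i j) = v i j by case: (XP i).
  rewrite (diag_signE (v := y) (a := d) tpos).
  - rewrite big_sumType /=; congr (_ + _).
    rewrite -(sig_big_dep (fun=> true) (fun _ _ => true) (fun i j => (-1) ^+ a i j)) /=.
    by apply: eq_bigr => i _; have [_ _ _ ->] := XP i.
  - move=> [[i x]|x] [[j z]|z] /=; last exact: uc.
    + have [ij|ij] := eqVneq i j.
        case: _ / ij z => z; have [va _ _ _] := XP i.
        rewrite [LHS]va; congr (if _ then _ else _).
        by rewrite -[RHS]/(Tagged I x == Tagged I z) eq_Tagged.
      apply: etrans (act_orthogonal (z := idem i) (z' := idem j) _ (vE i x) (vE j z)) _.
        by rewrite idem_mul_idem (negPf ij).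
      by case: eqP => // -[/eqP]; rewrite (negPf ij).
    + by apply: act_orthogonal (vE i x) (uE z); rewrite ext_mulC coidem_idem.
    + by apply: act_orthogonal (uE x) (vE j z); rewrite coidem_idem.
  move=> x.
  have vs i : spans (v i) (act (idem i) x) by case: (XP i).
  have [f fE] := us x.
  exists (fun t : T => match t with
    | inl p => sval (cid (vs (tag p))) (tagged p) | inr j => f j end).
  rewrite big_sumType /= -fE.
  rewrite -(sig_big_dep (fun=> true) (fun _ _ => true)
    (fun i j => v i j *r sval (cid (vs i)) j)) /=.
  under eq_bigr do rewrite -(svalP (cid (vs _))).
  have one : 1 = \sum_(i < r) idem i + E0 by rewrite addrC subrK.
  rewrite -[LHS]field_act1 one field_actDl.
  congr (_ + _); apply: (additive_sum (f := fun z => act z x)) => z z'.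
  exact: field_actDl.
have S0 := total w b wb wE (fun x => ws _ (E0E0 x)).
have JwE j : act E0 (act J (w j)) = act J (w j) by rewrite -field_actM EJ.
(* On the remainder h(Jx, Jy) = h(x, J^2 y) = -h(x, y), so every sign flips. *)
have Jw : orthonormal (fun j => act J (w j)) (fun j => ~~ b j).
  move=> i j; rewrite field_act_adj -field_actM JJ act_opp wE (herm_Nr hVP) wb.
  by case: eqP => _; rewrite ?oppr0 // signrN.
have Jws x : spans (fun j => act J (w j)) (act E0 x).
  have EJx : act E0 (act J x) = act J x by rewrite -field_actM EJ.
  have [c cE] := ws _ EJx.
  (* As [act E0 x] is -J(J x), the coordinates are minus those of J x along [w]. *)
  exists (fun j => - c j).
  rewrite -[E0]opprK -JJ act_opp field_actM cE (additive_sum (field_actD J)).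
  rewrite -sumrN; apply: eq_bigr => j _.
  by rewrite field_actZ /rmul scaleNr.
have S1 := total _ _ Jw JwE Jws.
(* Both bases compute the signature of V, so the share of the remainder equals its own negative. *)
have /eqP : \sum_j (-1) ^+ b j = \sum_j (-1) ^+ (~~ b j) :> int.
  by apply: (addrI (\sum_(i < r) sign (branch M h i))); rewrite -S0 -S1.
under [X in _ == X]eq_bigr do rewrite signrN.
rewrite sumrN -addr_eq0 -mulr2n Num.Theory.mulrn_eq0 /= => /eqP b0.
by rewrite S0 b0 addr0.
Qed.

End SignatureSum.

Theorem theorem5p1
  (F : fieldType) (A : falgType F) (sigma : alg_involution A)
  (P : ordering F) (L : fieldExtType F)
  (K : rcfType) (iota : {rmorphism F -> K}) (S : splitting L iota)
  (k : kind) (M : morita (ext_inv iota sigma) k (eps_at sigma k))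
  (h : hform (ext_inv (in_alg L) sigma) false) :
  formally_real F -> formally_real L ->
  algebra_with_involution sigma ->
  real_closure P iota ->
  kind_at sigma P iota k ->
  nonsingular_hform h ->
  sign_base M (transfer h) =
  \sum_(i < sp_r S)
    sign_ext (ext_transport (omega_iota0_bij i) (omega_compat (sp_lin i)) M) h.
Proof.
move=> _ _ _ _ _ hns; rewrite -[LHS]/(sign (morita_transfer M h)).
(* Each summand on the right is the sign of a [branch] by definition. *)
transitivity (\sum_(i < sp_r S) sign (branch M h i)); last by [].
(* For the exchange involution and for skew-hermitian values, [sign] is 0 by definition on both
   sides. *)
have [kE|kE] : k = DExch \/ k <> DExch by case: (k); [right|right|right|left].
  by rewrite sign_eq0 ?big1 => // [i _|]; [apply: sign_eq0|]; left.
case: (eps_at sigma k) M => M.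
  by rewrite sign_eq0 ?big1 => // [i _|]; [apply: sign_eq0|]; right.
by rewrite sign_diag //; exact: diag_sign_morita_transfer.
Qed.
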